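(* Let $p$ be an odd prime and $G$ a finite non-abelian $p$-group with cyclic center. If $C_G(\gamma_3(G)G^p)\not\le\gamma_3(G)G^p$, then $G$ has a non-inner automorphism of order $p$.
   Context: $\gamma_3(G)$ is the third term of the lower central series and $G^p=\langle g^p:g\in G\rangle$. *)

(* Defs.v *)
From mathcomp Require Import all_boot all_fingroup all_solvable.
Set Implicit Arguments. Unset Strict Implicit. Unset Printing Implicit Defensive.
Import GroupScope.

Definition pow_subgroup (gT : finGroupType) (G : {set gT}) (p : nat) : {set gT} :=
  <<[set x ^+ p | x in G]>>.

Definition inner_aut (gT : finGroupType) (G : {set gT}) (a : {perm gT}) : Prop :=
  exists2 g, g \in G & {in G, forall x, a x = x ^ g}.

(* Main.v *)
(* Suppose that every automorphism of order p is inner, and let z generate the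
   subgroup of order p of Z(G).  If E is a normal elementary abelian subgroup
   and chi : E -> F_p is a homomorphism with chi z = 1, then e |-> (g |-> chi
   (e ^ g)) embeds E into the functions G -> F_p, because every nontrivial
   normal subgroup contains z.  An E-invariant function f all of whose
   differences g |-> f g - f (x g) come from E yields a crossed homomorphism
   G -> E, hence an automorphism of order p or 1, which has to be conjugation by
   some y in G; then f is said to be realized by y.

   Realizing linear functions produces Z2 = {x | [x, G] <= <z>} with
   C_G(Z2) = Phi(G); realizing squares of linear functions gives Z2 <= Phi(G)
   and shows that the elements of order p of Z2 lie in N = L_3(G) G^p.  The
   quotient G / N has class at most 2 and exponent p, so every homomorphism
   Phi(G) / N -> F_p extends to a quadratic function on G; realizing such
   functions, an element of C_G(N) outside N produces h, t with h ^ p = 1 and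
   1 <> [h, t] in <z>.  Finally, for a suitable linear l and polynomial s of
   degree at most 3, the function l g * chi (h ^ g) + s g can be realized, by y
   say, but [t, y] would be central while representing a multiple of l.

   The recurrent difficulty is that an element y realizing a function may have
   y ^ p <> 1.  Since y ^ p lies in the cyclic group Z(G), this obstruction takes
   values in a group of order p, and the correction s is chosen to kill it. *)

Require Import Defs.
From mathcomp Require Import all_boot all_fingroup all_solvable.
From mathcomp Require Import all_algebra ring.
Import GroupScope.
Set Implicit Arguments. Unset Strict Implicit. Unset Printing Implicit Defensive.
Import GRing.Theory.

(** * Additive functions with values in F_p *)

Definition additive_on (gT : finGroupType) (p : nat) (A : {set gT}) (l : gT -> 'F_p) :=
  {in A &, forall x y, l (x * y)%g = (l x + l y)%R}.

Lemma expg_natF (gT : finGroupType) (p : nat) (x : gT) (n : nat) :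
  prime p -> x ^+ p = 1 -> x ^+ (n%:R : 'F_p)%R = x ^+ n.
Proof. by move=> pr_p xp1; rewrite val_Fp_nat // expg_mod. Qed.

Lemma expgF_D (gT : finGroupType) (p : nat) (x : gT) (a b : 'F_p) :
  prime p -> x ^+ p = 1 -> x ^+ (a + b)%R = x ^+ a * x ^+ b.
Proof.
by move=> pr_p xp1; rewrite -expgD -(expg_natF (a + b)%N pr_p xp1) natrD !natr_Zp.
Qed.

Lemma ltn_F (p : nat) (a : 'F_p) : prime p -> a < p.
Proof. by move=> pr_p; rewrite -{2}(Fp_cast pr_p). Qed.

Lemma expgF_inj (gT : finGroupType) (p : nat) (x : gT) (a b : 'F_p) :
  prime p -> x ^+ p = 1 -> x != 1 -> x ^+ a = x ^+ b -> a = b.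
Proof.
move=> pr_p xp1 x1 /eqP; rewrite eq_expg_mod_order (nt_prime_order pr_p xp1) //.
by rewrite !modn_small ?ltn_F // => /eqP/val_inj.
Qed.

(** The line spanned by [c] in [P / N] has a complement [K], and [l] is the coordinate along [c]
    modulo [K]. *)
Lemma functional (gT : finGroupType) (P N : {group gT}) (p : nat) (c : gT) :
  prime p -> N <| P -> p.-abelem (P / N) -> c \in P -> c \notin N ->
  exists l : gT -> 'F_p,
    [/\ additive_on P l, {in N, forall x, l x = 0%R} & l c = 1%R].
Proof.
move=> pr_p nsNP abP cP cN.
have nNP := normal_norm nsNP.
have cPq : <[coset N c]> \subset P / N by rewrite cycle_subG mem_quotient.
have [K /dprodP[_ defP _ tiK]] := abelem_split_dprod abP cPq.
have cp1 : coset N c ^+ p = 1.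
  by case/abelemP: abP => // _; apply; rewrite mem_quotient.
have c1 : coset N c != 1.
  by apply: contra cN => /eqP; apply: coset_idr; apply: (subsetP nNP).
(* The default 0 is never taken on [P]. *)
pose l x : 'F_p := odflt 0%R [pick k : 'F_p | coset N x * (coset N c ^+ k)^-1 \in K].
have abel x y : x \in P / N -> y \in P / N -> commute x y.
  by move=> xP yP; apply: (centsP (abelem_abelian abP)).
have lP x : x \in P -> coset N x * (coset N c ^+ l x)^-1 \in K.
  move=> xP; rewrite /l; case: pickP => //= nok.
  have: coset N x \in <[coset N c]> * K by rewrite defP mem_quotient.
  case/mulsgP=> u v /cycleP[i ->] vK e.
  have := nok (i%:R)%R; rewrite expg_natF // e abel ?mulgK ?vK //.
    by rewrite (subsetP cPq) ?mem_cycle.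
  by rewrite -defP (subsetP (mulG_subr _ _)).
have lu x (k : 'F_p) : x \in P -> coset N x * (coset N c ^+ k)^-1 \in K -> l x = k.
  move=> xP xk.
  have: (coset N x * (coset N c ^+ l x)^-1)^-1 * (coset N x * (coset N c ^+ k)^-1) \in K.
    by rewrite groupM ?groupV ?lP.
  rewrite invMg invgK mulgA mulgKV => inK.
  have: coset N c ^+ l x * (coset N c ^+ k)^-1 \in <[coset N c]> :&: K.
    by rewrite inE inK groupM ?groupV ?mem_cycle.
  by rewrite tiK inE -eq_mulgV1 => /eqP; apply: expgF_inj.
exists l; split.
- move=> x y xP yP; apply: lu; first by rewrite groupM.
  have cX (k : nat) : coset N c ^+ k \in P / N by rewrite groupX ?mem_quotient.
  rewrite morphM ?(subsetP nNP) // expgF_D // invMg.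
  rewrite [_^-1 * _]abel ?groupV // mulgA -(mulgA (coset N x)) [coset N y * _]abel ?groupV ?mem_quotient //.
  by rewrite mulgA -mulgA groupM ?lP.
- move=> x xN; apply: lu; first by rewrite (subsetP (normal_sub nsNP)).
  by rewrite coset_id // mul1g invg1.
- by apply: (@lu c 1%:R%R); rewrite // expg_natF // expg1 mulgV.
Qed.

Lemma functional_sub (gT : finGroupType) (A : {group gT}) (p : nat) (c : gT) :
  prime p -> p.-abelem A -> c \in A -> c != 1 ->
  exists l : gT -> 'F_p, additive_on A l /\ l c = 1%R.
Proof.
move=> pr_p abA cA c1.
have abA1 : p.-abelem (A / 1%G) by rewrite quotient_abelem.
have c1' : c \notin 1%G by rewrite inE.
by have [l [lA _ lc]] := functional pr_p (normal1 A) abA1 cA c1'; exists l.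
Qed.

Lemma additive_on1 (gT : finGroupType) (p : nat) (A : {group gT}) (l : gT -> 'F_p) :
  additive_on A l -> l 1%g = 0%R.
Proof.
by move=> lA; apply: (addIr (l 1)); rewrite -lA // mulg1 add0r.
Qed.

Lemma additive_onX (gT : finGroupType) (p : nat) (A : {group gT}) (l : gT -> 'F_p) x n :
  additive_on A l -> x \in A -> l (x ^+ n) = (l x *+ n)%R.
Proof.
move=> lA xA; elim: n => [|n IH]; first by rewrite (additive_on1 lA).
by rewrite expgS lA ?groupX // IH mulrS.
Qed.

Lemma additive_onXF (gT : finGroupType) (p : nat) (A : {group gT}) (l : gT -> 'F_p) x (c : 'F_p) :
  additive_on A l -> x \in A -> l (x ^+ c) = (c * l x)%R.
Proof. by move=> lA xA; rewrite (additive_onX _ lA) // -mulr_natl natr_Zp. Qed.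

Lemma additive_onV (gT : finGroupType) (p : nat) (A : {group gT}) (l : gT -> 'F_p) x :
  additive_on A l -> x \in A -> l (x^-1) = (- l x)%R.
Proof.
move=> lA xA; apply: (addrI (l x)).
by rewrite -lA ?groupV // mulgV subrr (additive_on1 lA).
Qed.

Lemma mulrn_Fp (p : nat) (a : 'F_p) : prime p -> (a *+ p = 0)%R.
Proof. by move=> pr_p; rewrite -mulr_natl pchar_Fp_0 // mul0r. Qed.

Lemma additive_on_Phi (gT : finGroupType) (p : nat) (G : {group gT}) (l : gT -> 'F_p) :
  prime p -> p.-group G -> additive_on G l -> {in 'Phi(G), forall x, l x = 0%R}.
Proof.
move=> pr_p pG lG.
have gK : group_set [set x in G | l x == 0%R].
  apply/group_setP; split; first by rewrite inE group1 (additive_on1 lG) eqxx.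
  move=> x y; rewrite !inE => /andP[xG /eqP lx] /andP[yG /eqP ly].
  by rewrite groupM //= lG // lx ly addr0.
suff: 'Phi(G) \subset Group gK by move=> /subsetP s x /s; rewrite inE => /andP[_ /eqP].
rewrite (Phi_joing pG) join_subG gen_subG; apply/andP; split.
  apply/subsetP=> _ /imset2P[x y xG yG ->]; rewrite inE groupR //.
  rewrite commgEl conjgE !lG ?groupM ?groupV // !(additive_onV lG) //.
  by apply/eqP; ring.
rewrite (MhoE _ pG) gen_subG; apply/subsetP=> _ /imsetP[x xG ->].
by rewrite inE groupX // (additive_onX _ lG) // expn1 mulrn_Fp ?eqxx.
Qed.

(** * Correcting elements to order p with the help of a cyclic center *)

(** The exponent of [a] over a generator is either divisible by [p], or prime to [p], in which case
    [a] is itself a generator. *)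
Lemma cyclic_pgroup_root (gT : finGroupType) (Z : {group gT}) (p : nat) (a b : gT) :
  prime p -> p.-group Z -> cyclic Z -> a \in Z -> b \in Z ->
  (exists2 u, u \in Z & a = u ^+ p) \/ (exists k, b = a ^+ k).
Proof.
move=> pr_p pZ /cyclicP[x defZ] aZ bZ; rewrite defZ in aZ bZ pZ *.
have [m am] := cycleP _ _ aZ; rewrite am in aZ *.
have [/dvdnP[q ->] | pm] := boolP (p %| m)%N.
  by left; exists (x ^+ q); rewrite ?mem_cycle // expgM.
right; apply/cycleP; rewrite -(_ : <[x]> = <[x ^+ m]>) //; apply/eqP.
by rewrite [_ == _]generator_coprime (pnat_coprime pZ) // p'natE.
Qed.

(** The device against elements whose p-th power is not 1. If [u ^+ p] is a p-th power in the
    center, a central factor corrects [u]; otherwise [u ^+ p] generates the center, so [v ^+ p] is a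
    power of it. *)
Lemma fix_order (gT : finGroupType) (G : {group gT}) (p : nat) (u v : gT) :
    prime p -> odd p -> p.-group G -> cyclic 'Z(G) -> u \in G -> v \in G ->
    [~ u, v] \in 'Z(G) -> [~ u, v] ^+ p = 1 -> u ^+ p \in 'Z(G) -> v ^+ p \in 'Z(G) ->
  (exists2 w, w \in 'Z(G) & (u * w^-1) ^+ p = 1) \/ (exists k, (v * u ^- k) ^+ p = 1).
Proof.
move=> pr_p odd_p pG cZ uG vG Zuv uvp Zu Zv.
have pZ : p.-group 'Z(G) by apply: pgroupS pG; apply: center_sub.
have cen x y : x \in 'Z(G) -> y \in G -> commute x y.
  by move=> /centerP[_ xc] /xc.
have [[w wZ uw] | [k vk]] := cyclic_pgroup_root pr_p pZ cZ Zu Zv; [left | right].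
  exists w => //; rewrite expgMn ?expgVn ?uw ?mulgV //.
  by apply/commute_sym/cen; rewrite ?groupV.
exists k.
have cu : commute u [~ u, v] by apply/commute_sym/cen.
have cku : commute (u ^+ k) [~ u ^+ k, v].
  by rewrite commXg //; apply/commuteX2.
have e : [~ u ^- k, v] = [~ u, v] ^- k by rewrite commVg // commXg.
have Ze : [~ u, v] ^- k \in 'Z(G) by rewrite groupV groupX.
(* Collecting the p-th power leaves a commutator to the power ['C(p, 2)], a multiple of [p] since
   [p] is odd. *)
rewrite expMg_Rmul e; last 2 first.
- by apply/commute_sym/cen; rewrite // groupV groupX.
- by apply/commute_sym/cen.
have -> : ([~ u, v] ^- k) ^+ 'C(p, 2) = 1.
  by rewrite bin2odd // expgM expgVn -(expgM _ k) mulnC expgM uvp expg1n invg1 expg1n.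
by rewrite mulg1 vk expgVn -!expgM mulnC mulgV.
Qed.

(** * Extending a function from Phi(G) to a quadratic function on G *)

(* [j] and [B] are extended step by step along a chain of subgroups from Phi(G)
   to G, each generated by one more element. *)
Lemma biadditive_cocycle (gT : finGroupType) (G : {group gT}) (p : nat) (phi : gT -> 'F_p) :
    prime p -> p.-group G -> additive_on 'Phi(G) phi ->
    (forall f g, f \in 'Phi(G) -> g \in G -> phi [~ f, g] = 0%R) ->
    (forall g, g \in G -> phi (g ^+ p) = 0%R) ->
  exists j : gT -> 'F_p, exists B : gT -> gT -> 'F_p,
    [/\ {in G &, forall x y, j (x * y)%g = j x + j y + B x y}%R,
        {in G, forall x, additive_on G (B x)},
        {in G, forall y, additive_on G (B^~ y)} &
        {in 'Phi(G), forall f, j f = phi f}].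
Proof.
move=> pr_p pG phiD phiR phiX.
have [sG'Phi MhoPhi] : G^`(1) \subset 'Phi(G) /\ (forall g, g \in G -> g ^+ p \in 'Phi(G)).
  rewrite (Phi_joing pG) joing_subl; split=> // g gG.
  apply: (subsetP (joing_subr _ _)); rewrite -[p in g ^+ p]expn1.
  by apply: Mho_p_elt => //; apply: mem_p_elt pG gG.
have RPhi x y : x \in G -> y \in G -> [~ x, y] \in 'Phi(G).
  by move=> xG yG; apply: (subsetP sG'Phi); apply: mem_commg.
have PhiG f : f \in 'Phi(G) -> f \in G by apply: (subsetP (Phi_sub G)).
have PhiJ f g : f \in 'Phi(G) -> g \in G -> f ^ g \in 'Phi(G).
  by move=> fP gG; rewrite memJ_norm // (subsetP (gFnorm _ _)).
have phiJ f g : f \in 'Phi(G) -> g \in G -> phi (f ^ g) = phi f.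
  by move=> fP gG; rewrite conjg_mulR phiD ?RPhi ?phiR ?addr0 // PhiG.
have R1 x y w : x \in G -> y \in G -> w \in G ->
    phi [~ x * y, w] = (phi [~ x, w] + phi [~ y, w])%R.
  by move=> xG yG wG; rewrite commMgJ phiD ?phiJ ?PhiJ ?RPhi.
have R2 x y w : x \in G -> y \in G -> w \in G ->
    phi [~ w, x * y] = (phi [~ w, x] + phi [~ w, y])%R.
  by move=> xG yG wG; rewrite commgMJ phiD ?phiJ ?PhiJ ?RPhi // addrC.
have RX x w n : x \in G -> w \in G -> phi [~ w, x ^+ n] = (phi [~ w, x] *+ n)%R.
  by move=> xG wG; rewrite (additive_onX (A := G) (l := fun y => phi [~ w, y])) // => y z yG zG; apply: R2.
(* [B] is also required to vanish when one argument is in Phi(G), so that error terms in Phi(G) do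
   not affect it. *)
pose good (L : {group gT}) := [/\ 'Phi(G) \subset L, L \subset G &
  exists j : gT -> 'F_p, exists B : gT -> gT -> 'F_p,
    [/\ {in L &, forall x y, j (x * y)%g = j x + j y + B x y}%R,
        {in L, forall x, additive_on L (B x)},
        {in L, forall y, additive_on L (B^~ y)},
        {in 'Phi(G) & L, forall f x, B f x = 0%R /\ B x f = 0%R} &
        {in 'Phi(G), forall f, j f = phi f}]].
have good0 : good 'Phi(G)%G.
  split=> //; first exact: Phi_sub.
  exists phi, (fun _ _ => 0%R); split=> //; first by move=> x y xP yP; rewrite phiD // addr0.
    by move=> x xP y z; rewrite addr0.
  by move=> x xP y z; rewrite addr0.
have step L : good L -> L != G -> exists2 L' : {group gT}, good L' & #|L| < #|L'|.
  case=> sPL sLG [j [B [jB B1 B2 BPhi jphi]]] neLG.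
  have /properP[_ [g gG gL]] : L \proper G by rewrite properEneq neLG.
  have sRL : G^`(1) \subset L by apply: subset_trans sPL.
  have nLG : G \subset 'N(L) by apply: sub_der1_norm.
  pose L' := (L <*> <[g]>)%G.
  have defL' : L * <[g]> = L'.
    by rewrite /= norm_joinEr // cycle_subG (subsetP nLG).
  have sL'G : L' \subset G by rewrite join_subG sLG cycle_subG.
  have sLL' : L \subset L' by apply: joing_subl.
  have gL' : g \in L' by rewrite -cycle_subG joing_subr.
  have L'G x : x \in L' -> x \in G by apply: (subsetP sL'G).
  have LG x : x \in L -> x \in G by apply: (subsetP sLG).
  have nsLL' : L <| L' by rewrite /normal sLL' (subset_trans sL'G).
  have abQ : p.-abelem (L' / L).
    apply/abelemP => //; split.
      apply: abelianS (quotientS L sL'G) _; apply: sub_der1_abelian sRL.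
    move=> _ /morphimP[x nx xL' ->]; rewrite -morphX //= coset_id //.
    by apply: (subsetP sPL); apply: MhoPhi; apply: L'G.
  have [l [lD lL lg]] := functional pr_p nsLL' abQ gL' gL.
  pose r x := x * g ^- l x.
  have rL x : x \in L' -> r x \in L.
    rewrite -{1}defL' => /mulsgP[u v uL /cycleP[n ->] ->{x}].
    have uL' := subsetP sLL' _ uL.
    rewrite /r lD ?groupX // lL // add0r (additive_onX _ lD) // lg.
    rewrite val_Fp_nat // -mulgA groupM // {1}(divn_eq n p) expgD mulgK mulnC expgM groupX //.
    by apply: (subsetP sPL); apply: MhoPhi.
  have rE x : r x * g ^+ l x = x by rewrite mulgKV.
  (* In the normal form [x = r x * g ^+ l x], the part [r] is multiplicative up to an error [f]: the
     commutator from moving [g ^- l x] past [r y], times the carry in the exponent of [g], a power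
     of [g ^+ p] on which [phi] vanishes. *)
  have rM x y : x \in L' -> y \in L' -> exists2 f, f \in 'Phi(G) & 
      r (x * y) = r x * r y * f /\ phi f = (l x * phi [~ r y, g^-1])%R.
    move=> xL' yL'.
    have [rxG ryG] : r x \in G /\ r y \in G by split; apply/LG/rL.
    pose m := (l x + l y)%N.
    have val_l : l (x * y) = (m %% p)%N :> nat by rewrite lD // -(val_Fp_nat pr_p) natrD !natr_Zp.
    have gm : g ^+ m * g ^- (m %% p) = (g ^+ p) ^+ (m %/ p).
      by rewrite {1}(divn_eq m p) expgD mulgK mulnC expgM.
    have gmP : (g ^+ p) ^+ (m %/ p) \in 'Phi(G) by rewrite groupX ?MhoPhi.
    have RP : [~ r y, g ^- l x] \in 'Phi(G) by rewrite RPhi ?groupV ?groupX.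
    exists ([~ r y, g ^- l x] * (g ^+ p) ^+ (m %/ p)); first by rewrite groupM.
    split.
      have -> : r (x * y) = x * y * g ^- (m %% p) by rewrite /r val_l.
      rewrite -gm -[in LHS](rE x) -[in LHS](rE y) expgD !mulgA; congr (_ * _ * _).
      by rewrite /r !invMg !invgK !mulgA !mulgKV mulgK mulgKV.
    rewrite phiD // (additive_onX _ phiD) ?MhoPhi // phiX // mul0rn addr0.
    by rewrite -expgVn RX ?groupV // -mulr_natl natr_Zp.
  have rPhi f : f \in 'Phi(G) -> r f = f.
    by move=> fP; rewrite /r lL ?(subsetP sPL) // expg0 invg1 mulg1.
  have lPhi f : f \in 'Phi(G) -> l f = 0%R.
    by move=> fP; rewrite lL ?(subsetP sPL).
  exists L'; last by apply: proper_card; rewrite properE sLL' /=; apply: contra gL => /subsetP->.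
  split=> //; first by apply: subset_trans sLL'.
  have inL f : f \in 'Phi(G) -> f \in L by apply: (subsetP sPL).
  have phiR1 f : f \in 'Phi(G) -> phi [~ f, g^-1] = 0%R by move=> fP; rewrite phiR ?groupV.
  (* The new [j] ignores the power of [g]; its polarization acquires the value of [phi] on the error
     [f]. *)
  exists (fun x => j (r x)), (fun x y => B (r x) (r y) + l x * phi [~ r y, g^-1])%R.
  split.
  - move=> x y xL' yL' /=; have [f fP [-> phif]] := rM x y xL' yL'.
    have [rx ry] := (rL x xL', rL y yL').
    have fL := inL f fP; have rxy := groupM rx ry.
    rewrite (jB _ _ rxy fL) (jB _ _ rx ry) (jphi _ fP) phif.
    by rewrite (proj2 (BPhi _ _ fP rxy)); ring.
  - move=> x xL' y z yL' zL' /=; have [f fP [-> _]] := rM y z yL' zL'.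
    have [rx [ry rz]] := (rL x xL', (rL y yL', rL z zL')).
    have fL := inL f fP; have ryz := groupM ry rz; have gVG := groupVr gG.
    rewrite (B1 _ rx _ _ ryz fL) (B1 _ rx _ _ ry rz) (proj2 (BPhi _ _ fP rx)).
    rewrite (R1 _ _ _ (LG _ ryz) (LG _ fL) gVG) (R1 _ _ _ (LG _ ry) (LG _ rz) gVG).
    by rewrite (phiR1 _ fP); ring.
  - move=> y yL' x z xL' zL' /=; have [f fP [-> _]] := rM x z xL' zL'.
    have [rx [ry rz]] := (rL x xL', (rL y yL', rL z zL')).
    have fL := inL f fP; have rxz := groupM rx rz.
    rewrite (B2 _ ry _ _ rxz fL) (B2 _ ry _ _ rx rz) (proj1 (BPhi _ _ fP ry)) lD //.
    by ring.
  - move=> f x fP xL' /=; rewrite lPhi // rPhi // (phiR1 _ fP).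
    have [-> ->] := BPhi _ _ fP (rL x xL'); split; ring.
  - by move=> f fP; rewrite rPhi // jphi.
have ind n L : good L -> #|G| - #|L| < n -> good G.
  elim: n L => // n IH L gdL; have [eLG | neLG] := eqVneq (L : {set gT}) G.
    by rewrite -(group_inj eLG).
  have [L' gdL' lt] := step L gdL neLG; rewrite ltnS => le; apply: (IH L') => //.
  have [_ sL'G _] := gdL'; have := subset_leq_card sL'G.
  by move=> ?; apply: leq_trans le; apply: ltn_sub2l => //; apply: leq_trans lt _.
have [_ _ [j [B [jB B1 B2 _ jphi]]]] := ind _ _ good0 (ltnSn _).
by exists j, B.
Qed.

(** * Realizing functions by inner automorphisms *)

Section NoOuterAutomorphism.

Variables (gT : finGroupType) (G : {group gT}) (p : nat) (z : gT).
Hypotheses (pr_p : prime p) (odd_p : odd p) (pG : p.-group G).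
Hypothesis nabG : ~~ abelian G.
Hypotheses (cZ : cyclic 'Z(G)) (zZ : z \in 'Z(G)) (oz : #[z] = p).
Hypothesis inner_p : forall a : {perm gT}, a \in Aut G -> #[a] = p ->
  exists2 y, y \in G & {in G, forall x, a x = x ^ y}.

Implicit Types (E H : {group gT}) (chi : gT -> 'F_p).

(* Functions G -> F_p are modelled by total functions on gT, and only their
   values on G matter. *)
Definition dif (f : gT -> 'F_p) x g : 'F_p := (f g - f (x * g)%g)%R.

(** Membership of [f], restricted to [G], in the image of the embedding of [E] into functions. *)
Definition rep E chi (f : gT -> 'F_p) := [exists e in E, [forall g in G, chi (e ^ g) == f g]].

(** The normalization [chi z = 1] makes the embedding injective and lets powers of [z] represent the
    constants. *)
Definition frame E chi :=
  [/\ E <| G, p.-abelem E, z \in E, additive_on E chi & chi z = 1%R].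

Lemma repP E chi f :
  reflect (exists2 e, e \in E & forall g, g \in G -> chi (e ^ g) = f g) (rep E chi f).
Proof.
apply: (iffP exists_inP) => [] [e eE ef]; exists e => //.
  by move=> g gG; apply/eqP/(forall_inP ef).
by apply/forall_inP=> g gG; apply/eqP/ef.
Qed.

Lemma zG : z \in G. Proof. by case/centerP: zZ. Qed.
Lemma z1 : z != 1. Proof. by rewrite -order_gt1 oz prime_gt1. Qed.
Lemma zp : z ^+ p = 1. Proof. by rewrite -oz expg_order. Qed.
Lemma zC g : g \in G -> commute z g. Proof. by case/centerP: zZ => _; apply. Qed.
Lemma zJ g : g \in G -> z ^ g = z. Proof. by move/zC=> e; rewrite conjgE e mulKg. Qed.

(** [H] meets the center, and the cyclic center has a single subgroup of order p. *)
Lemma z_in_normal H : H <| G -> H :!=: 1 -> z \in H.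
Proof.
move=> nsHG ntH.
have ntK : H :&: 'Z(G) != 1 by apply: meet_center_nil => //; apply: pgroup_nil pG.
have sKZ : H :&: 'Z(G) \subset 'Z(G) by apply: subsetIr.
have pK : p.-group (H :&: 'Z(G)).
  by apply: pgroupS pG; apply: subset_trans sKZ (center_sub G).
have [_ dvK _] := pgroup_pdiv pK ntK.
have [x xK ox] := Cauchy pr_p dvK.
have sxZ : <[x]> \subset 'Z(G) by rewrite cycle_subG (subsetP sKZ).
have szZ : <[z]> \subset 'Z(G) by rewrite cycle_subG.
have exz : <[x]> = <[z]>.
  by apply/eqP; rewrite [_ == _](eq_subG_cyclic cZ sxZ szZ) -!orderE ox oz.
have : z \in <[x]> by rewrite exz cycle_id.
by apply: subsetP; rewrite cycle_subG; case/setIP: xK.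
Qed.

(** * The embedding of a normal elementary abelian subgroup into functions *)

Section Frame.

Variables (E : {group gT}) (chi : gT -> 'F_p).
Hypothesis frameE : frame E chi.

Let nsEG : E <| G. Proof. by case: frameE. Qed.
Let sEG : E \subset G. Proof. exact: normal_sub. Qed.
Let abE : p.-abelem E. Proof. by case: frameE. Qed.
Let zE : z \in E. Proof. by case: frameE. Qed.
Let chiD : additive_on E chi. Proof. by case: frameE. Qed.
Let chiz : chi z = 1%R. Proof. by case: frameE. Qed.

Lemma frameJ e g : e \in E -> g \in G -> e ^ g \in E.
Proof. by move=> eE gG; rewrite memJ_norm // (subsetP (normal_norm nsEG)). Qed.

Lemma frame_p e : e \in E -> e ^+ p = 1.
Proof. by case/abelemP: abE => // _; apply. Qed.

Lemma frameC e1 e2 : e1 \in E -> e2 \in E -> commute e1 e2.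
Proof. by move=> e1E e2E; apply: (centsP (abelem_abelian abE)). Qed.

Lemma frame_zX (c : 'F_p) g : g \in G -> chi ((z ^+ c) ^ g) = c.
Proof. by move=> gG; rewrite conjXg zJ // (additive_onXF _ chiD) // chiz mulr1. Qed.

(** The kernel of the embedding is normal in [G] and omits [z], hence is trivial. *)
Lemma frame_inj e1 e2 : e1 \in E -> e2 \in E ->
  (forall g, g \in G -> chi (e1 ^ g) = chi (e2 ^ g)) -> e1 = e2.
Proof.
move=> e1E e2E e12.
pose K := [set e in E | [forall g in G, chi (e ^ g) == 0%R]].
have inK e : reflect (e \in E /\ forall g, g \in G -> chi (e ^ g) = 0%R) (e \in K).
  rewrite inE; apply: (iffP andP) => [] [eE ef]; split=> //.
    by move=> g gG; apply/eqP/(forall_inP ef).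
  by apply/forall_inP=> g gG; apply/eqP/ef.
have gK : group_set K.
  apply/group_setP; split.
    by apply/inK; split=> // g _; rewrite conj1g (additive_on1 chiD).
  move=> x y /inK[xE xf] /inK[yE yf]; apply/inK; split; first by rewrite groupM.
  by move=> g gG; rewrite conjMg chiD ?frameJ // xf // yf // addr0.
have sKE : K \subset E by apply/subsetP=> x /inK[].
have nsK : Group gK <| G.
  rewrite /normal /= (subset_trans sKE) //=; apply/normsP=> x xG; apply/setP=> y.
  have dir u v : u \in K -> v \in G -> u ^ v \in K.
    case/inK=> uE uf vG; apply/inK; split; first exact: frameJ.
    by move=> g gG; rewrite -conjgM uf ?groupM.
  rewrite mem_conjg; apply/idP/idP => yK; last by apply: dir; rewrite ?groupV.
  by rewrite -(conjgKV x y) dir.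
have : e1 * e2^-1 \in Group gK.
  apply/inK; split; first by rewrite groupM ?groupV.
  move=> g gG; rewrite conjMg conjVg chiD ?groupV ?frameJ //.
  by rewrite (additive_onV chiD) ?frameJ // e12 // subrr.
have [-> | ntK] := eqVneq (Group gK : {set gT}) 1.
  by rewrite inE -eq_mulgV1 => /eqP.
have /inK[_ /(_ 1 (group1 G))] := z_in_normal nsK ntK.
by rewrite conjg1 chiz => /eqP; rewrite oner_eq0.
Qed.

Lemma rep_const (c : 'F_p) : rep E chi (fun=> c).
Proof. by apply/repP; exists (z ^+ c); [rewrite groupX | move=> g; apply: frame_zX]. Qed.

Lemma rep_add f1 f2 : rep E chi f1 -> rep E chi f2 -> rep E chi (fun g => f1 g + f2 g)%R.
Proof.
move=> /repP[e1 e1E h1] /repP[e2 e2E h2]; apply/repP; exists (e1 * e2).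
  by rewrite groupM.
by move=> g gG; rewrite conjMg chiD ?frameJ // h1 // h2.
Qed.

Lemma rep_scale (c : 'F_p) f : rep E chi f -> rep E chi (fun g => c * f g)%R.
Proof.
move=> /repP[e eE h]; apply/repP; exists (e ^+ c); first by rewrite groupX.
by move=> g gG; rewrite conjXg (additive_onXF _ chiD) ?frameJ // h.
Qed.

Lemma rep_eq f1 f2 : rep E chi f1 -> {in G, f1 =1 f2} -> rep E chi f2.
Proof. by move=> /repP[e eE h] f12; apply/repP; exists e => // g gG; rewrite h // f12. Qed.

(* The values of [dif f] define a crossed homomorphism [d : G -> E] that is
   trivial on [E], so [x |-> x * d x] is an automorphism whose [p]-th power is
   trivial. *)
Lemma realize f :
    (forall e g, e \in E -> g \in G -> f (e * g)%g = f g) ->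
    (forall x, x \in G -> rep E chi (dif f x)) ->
  exists2 y, y \in G & forall x, x \in G ->
    [~ x, y] \in E /\ forall g, g \in G -> chi ([~ x, y] ^ g) = dif f x g.
Proof.
move=> fE repf.
pose d x := odflt 1 [pick e in E | [forall g in G, chi (e ^ g) == dif f x g]].
have dP x : x \in G -> d x \in E /\ forall g, g \in G -> chi (d x ^ g) = dif f x g.
  move=> xG; rewrite /d; case: pickP => [e /andP[eE /forall_inP h] /= | no].
    by split=> // g gG; apply/eqP/h.
  by have /exists_inP[e eE h] := repf x xG; have := no e; rewrite eE h.
have dE x : x \in G -> d x \in E by case/dP.
have dG x : x \in G -> d x \in G by move/dE; apply: (subsetP sEG).
have dM x y : x \in G -> y \in G -> d (x * y) = d x ^ y * d y.
  move=> xG yG; have [dxE dyE] := (dE x xG, dE y yG).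
  have dxyE : d x ^ y \in E by apply: frameJ.
  apply: frame_inj; [by apply: dE; apply: groupM | by apply: groupM |].
  move=> g gG; have [xyG ygG] := (groupM xG yG, groupM yG gG).
  rewrite conjMg -conjgM (chiD (frameJ dxE ygG) (frameJ dyE gG)).
  rewrite (proj2 (dP _ xyG)) // (proj2 (dP _ xG)) //.
  by rewrite (proj2 (dP _ yG)) // /dif mulgA; ring.
have d1 e : e \in E -> d e = 1.
  move=> eE; have eG := subsetP sEG e eE; apply: frame_inj; rewrite ?dE //.
  move=> g gG; rewrite (proj2 (dP _ eG)) // conj1g (additive_on1 chiD) /dif fE //.
  by rewrite subrr.
pose al x := x * d x.
have alM : {in G &, {morph al : x y / x * y}}.
  by move=> x y xG yG; rewrite /al dM // conjgE !mulgA mulgK.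
pose alm := Morphism alM.
have alG x : x \in G -> al x \in G by move=> xG; rewrite groupM ?dG.
have inj_al : 'injm alm.
  apply/subsetP=> x; rewrite !inE => /andP[xG /eqP /=]; rewrite /al => xd.
  have xE : x \in E by rewrite -(mulgK (d x) x) xd mul1g groupV dE.
  by rewrite -xd d1 // mulg1.
have im_al : alm @* G = G.
  apply/eqP; rewrite eqEcard card_injm // leqnn andbT.
  by apply/subsetP=> _ /morphimP[x _ xG ->]; apply: alG.
have autE' := autE inj_al im_al.
pose a := aut inj_al im_al.
have aG : a \in Aut G by apply: Aut_aut.
(* [d] is trivial on [E], so [d (x * d x ^+ n) = d x] and each iteration multiplies by [d x] once
   more. *)
have aX n x : x \in G -> (a ^+ n) x = x * d x ^+ n.
  move=> xG; elim: n => [|n IH]; first by rewrite perm1 mulg1.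
  rewrite expgSr permM IH autE' ?groupM ?groupX ?dG //= /al.
  rewrite dM ?groupX ?dG // (d1 (d x ^+ n)) ?groupX ?dE // mulg1.
  rewrite conjgE (frameC (dE x xG) _) ?groupX ?dE // mulKg -mulgA.
  by rewrite -expgSr.
have ap : a ^+ p = 1.
  apply/permP=> x; rewrite perm1; case: (boolP (x \in G)) => xG.
    by rewrite aX // frame_p ?dE // mulg1.
  by rewrite (out_Aut _ xG) // groupX.
have [y yG ay] : exists2 y, y \in G & {in G, forall x, a x = x ^ y}.
  have [a1 | nta] := eqVneq a 1.
    by exists 1 => // x xG; rewrite a1 perm1 conjg1.
  by apply: inner_p => //; apply: nt_prime_order.
exists y => // x xG; suff -> : [~ x, y] = d x by apply: dP.
by rewrite commgEl -ay // autE' // /= /al mulKg.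
Qed.

End Frame.
Lemma abelem_join_cycle E h :
  p.-abelem E -> h ^+ p = 1 -> h \in 'C(E) -> p.-abelem (E <*> <[h]>).
Proof.
move=> abE hp hC; have shC : <[h]> \subset 'C(E) by rewrite cycle_subG.
rewrite (cprod_abelem p (cprodEY shC)) abE cycle_abelem ?pr_p ?orbT //.
by apply/dvdnP; move: hp => /eqP; rewrite -order_dvdn => /dvdnP.
Qed.

Lemma normal_join_cycle E h :
  E <| G -> h \in G -> (forall g, g \in G -> [~ h, g] \in E) -> E <*> <[h]> <| G.
Proof.
move=> nsEG hG hE; rewrite /normal join_subG (normal_sub nsEG) cycle_subG hG /=.
apply/subsetP=> g gG; rewrite inE conjYg -cycleJ join_subG cycle_subG.
rewrite (normP (subsetP (normal_norm nsEG) g gG)) joing_subl /= conjg_mulR groupM //.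
  by rewrite (subsetP (joing_subr _ _)) ?cycle_id.
by rewrite (subsetP (joing_subl _ _)) ?hE.
Qed.

Lemma frame_exists E : E <| G -> p.-abelem E -> z \in E -> exists chi, frame E chi.
Proof.
by move=> nsE abE zE; have [chi []] := functional_sub pr_p abE zE z1; exists chi.
Qed.

Lemma commute_commg (x y : gT) : commute x y -> [~ x, y] = 1.
Proof. by move=> cxy; apply/eqP/commgP. Qed.

Lemma cycle_z x : x \in <[z]> -> exists c : 'F_p, x = z ^+ c.
Proof. by case/cycleP=> i ->; exists (i%:R)%R; rewrite expg_natF // zp. Qed.

Lemma cycle_zZ x : x \in <[z]> -> x \in 'Z(G).
Proof. by apply: subsetP; rewrite cycle_subG. Qed.

Lemma cycle_zp x : x \in <[z]> -> x ^+ p = 1.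
Proof. by case/cycle_z=> c ->; rewrite -expgM mulnC expgM zp expg1n. Qed.

Lemma centerC x y : x \in 'Z(G) -> y \in G -> commute x y.
Proof. by case/centerP=> _ xC /xC. Qed.

Lemma centerJ x y : x \in 'Z(G) -> y \in G -> x ^ y = x.
Proof. by move=> xZ yG; rewrite conjgE (centerC xZ yG) mulKg. Qed.

Lemma zXF_inj (a b : 'F_p) : z ^+ a = z ^+ b -> a = b.
Proof. by apply: expgF_inj; rewrite ?zp ?z1. Qed.

Lemma frame_z : exists chi, frame <[z]> chi.
Proof.
apply: frame_exists; rewrite ?cycle_id //.
  by rewrite sub_center_normal // cycle_subG.
by rewrite cycle_abelem ?pr_p ?orbT // oz.
Qed.

Lemma z_in_Phi : z \in 'Phi(G).
Proof.
apply: z_in_normal; first exact: Phi_normal.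
by rewrite (trivg_Phi pG); apply: contra nabG; apply: abelem_abelian.
Qed.

(** * The subgroup [Z2] and its centralizer *)

(** The preimage in [G] of the center of [G / <[z]>]. *)
Definition Z2 := [set x in G | [forall g in G, [~ x, g] \in <[z]>]].

Lemma Z2P x : reflect (x \in G /\ forall g, g \in G -> [~ x, g] \in <[z]>) (x \in Z2).
Proof.
rewrite inE; apply: (iffP andP) => [] [xG] h; split=> //; first exact/forall_inP.
exact/forall_inP.
Qed.

Lemma Z2_commM x y g : x \in Z2 -> y \in G -> g \in G -> [~ x * y, g] = [~ x, g] * [~ y, g].
Proof.
case/Z2P=> xG xz yG gG; rewrite commMgJ centerJ //; exact/cycle_zZ/xz.
Qed.

Lemma Z2_commMr x g h : x \in Z2 -> g \in G -> h \in G -> [~ x, g * h] = [~ x, g] * [~ x, h].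
Proof.
case/Z2P=> xG xz gG hG; rewrite commgMJ (centerJ (cycle_zZ (xz g gG)) hG).
exact: (centerC (cycle_zZ (xz h hG)) (groupR xG gG)).
Qed.

Lemma Z2_group_set : group_set Z2.
Proof.
apply/group_setP; split; first by apply/Z2P; split=> // g _; rewrite comm1g.
move=> x y xZ yZ; have [[xG xz] [yG yz]] := (Z2P x xZ, Z2P y yZ).
apply/Z2P; split=> [|g gG]; first exact: groupM.
by rewrite Z2_commM //; apply: groupM; [apply: xz | apply: yz].
Qed.
Canonical Z2_group := Group Z2_group_set.

Lemma center_Z2 x : x \in 'Z(G) -> x \in Z2.
Proof.
move=> xZ; have /centerP[xG _] := xZ; apply/Z2P; split=> // g gG.
by rewrite (commute_commg (centerC xZ gG)).
Qed.

Lemma Z2_normal : Z2 <| G.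
Proof.
rewrite /normal; apply/andP; split; first by apply/subsetP=> x /Z2P[].
apply/subsetP=> g gG; rewrite inE; apply/subsetP=> _ /imsetP[x xZ ->].
have [xG xz] := Z2P x xZ; rewrite conjg_mulR groupM //.
exact/center_Z2/cycle_zZ/xz.
Qed.

Lemma Z2_p x : x \in Z2 -> x ^+ p \in 'Z(G).
Proof.
case/Z2P=> xG xz; apply/centerP; split=> [|g gG]; first by rewrite groupX.
apply/commgP; rewrite commXg ?cycle_zp ?xz //.
by apply/commute_sym/centerC => //; apply/cycle_zZ/xz.
Qed.

Lemma Z2_hom x : x \in Z2 ->
  exists2 l : gT -> 'F_p, additive_on G l & forall g, g \in G -> [~ x, g] = z ^+ l g.
Proof.
move=> xZ; have [xG xz] := Z2P x xZ; have [chi frz] := frame_z.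
have [_ _ _ chiD chiz] := frz.
exists (fun g => chi [~ x, g]).
  by move=> g h gG hG; rewrite Z2_commMr // chiD ?xz.
move=> g gG; have [c ->] := cycle_z (xz g gG).
by rewrite (additive_onXF _ chiD) ?cycle_id // chiz mulr1.
Qed.

(** Converse of [Z2_hom]: the differences of [- l] are constants, hence represented by powers of
    [z], and the realizing element serves as [x]. *)
Lemma hom_Z2 (l : gT -> 'F_p) : additive_on G l ->
  exists2 x, x \in Z2 & forall g, g \in G -> [~ g, x] = z ^+ l g.
Proof.
move=> lD; have [chi frz] := frame_z; have [_ _ _ chiD chiz] := frz.
have lPhi := additive_on_Phi pr_p pG lD.
have difl x g : x \in G -> g \in G -> dif (fun g => - l g)%R x g = l x.
  by move=> xG gG; rewrite /dif lD //; ring.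
have [|x xG|y yG hy] := @realize _ _ frz (fun g => - l g)%R.
- move=> e g ez gG; have eP : e \in 'Phi(G).
    by apply: subsetP ez; rewrite cycle_subG z_in_Phi.
  have eG := subsetP (Phi_sub G) e eP.
  by rewrite (lD _ _ eG gG) (lPhi _ eP) add0r.
- by apply: rep_eq (rep_const frz (l x)) _ => g gG; rewrite difl.
have hy' g : g \in G -> [~ g, y] = z ^+ l g.
  move=> gG; have [gz hg] := hy g gG; have [c ec] := cycle_z gz.
  move: (hg 1 (group1 G)); rewrite difl // ec (frame_zX frz) // => ->; by [].
exists y => //; apply/Z2P; split=> // g gG.
by rewrite -invg_comm groupV hy' // mem_cycle.
Qed.

(** Commutation with the elements of [Z2] gives exactly the homomorphisms from [G] to F_p, whose
    common kernel is Phi(G). *)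
Lemma cent_Z2 : 'C_G(Z2) = 'Phi(G).
Proof.
apply/eqP; rewrite eqEsubset; apply/andP; split; last first.
  rewrite subsetI Phi_sub; apply/centsP=> f fP x xZ.
  have [l lD xl] := Z2_hom xZ; have fG := subsetP (Phi_sub G) f fP.
  by apply/commute_sym/commgP; rewrite xl // (additive_on_Phi pr_p pG lD).
apply/subsetP=> g /setIP[gG gC]; apply: contraT => gP.
have [l [lD _ lg]] := functional pr_p (Phi_normal G) (Phi_quotient_abelem pG) gG gP.
have [x xZ xl] := hom_Z2 lD.
have := xl g gG; rewrite (commute_commg (centP gC x xZ)) lg => e.
have : (0 : 'F_p)%R = 1%R by apply: zXF_inj; rewrite expg0.
by move/eqP; rewrite eq_sym oner_eq0.
Qed.

Lemma two_neq0 : (2%:R : 'F_p)%R != 0%R.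
Proof.
apply/negP=> /eqP/(congr1 (@nat_of_ord _)); rewrite val_Fp_nat //=.
have p2 : p != 2%N by apply: contraTneq odd_p => ->.
by rewrite modn_small // ltn_neqAle eq_sym p2 prime_gt1.
Qed.

Lemma mulf2_neq0 (a : 'F_p) : a != 0%R -> (2%:R * a)%R != 0%R.
Proof. by move=> a0; rewrite mulf_neq0 ?two_neq0. Qed.

(* Realizes the square of the F_p-valued homomorphism attached to [w]. *)
Lemma square_realize w : w \in Z2 -> w ^+ p = 1 ->
  exists2 y, y \in G & forall x, x \in G ->
    [/\ [~ x, y] \in <[z]> <*> <[w]>, x \in 'Phi(G) -> [~ x, y] = 1
      & [~ w, x] != 1 -> [~ x, y] \notin <[z]>].
Proof.
move=> wZ wp; have [wG wz] := Z2P w wZ; have [l lD wl] := Z2_hom wZ.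
have wcz : w \in 'C(<[z]>).
  by rewrite cent_cycle; apply/cent1P/commute_sym/zC.
have [chi0 [nsz abz zz _ _]] := frame_z.
have [|||chi frE] := @frame_exists (<[z]> <*> <[w]>)%G.
- exact: normal_join_cycle.
- exact: abelem_join_cycle.
- by rewrite (subsetP (joing_subl _ _)).
have [nsE abE zE chiD chiz] := frE.
have wE : w \in <[z]> <*> <[w]> by rewrite (subsetP (joing_subr _ _)) ?cycle_id.
have jE g : g \in G -> chi (w ^ g) = (chi w + l g)%R.
  move=> gG; rewrite conjg_mulR wl // chiD ?groupX // (additive_onXF _ chiD) //.
  by rewrite chiz mulr1.
have lE e : e \in <[z]> <*> <[w]> -> l e = 0%R.
  move=> eE; apply: zXF_inj; rewrite -wl ?(subsetP (normal_sub nsE)) // expg0.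
  by apply: commute_commg; apply: (frameC frE).
(* [f] is the square of [g |-> chi (w ^ g)], so its differences are affine in that function and are
   represented by products of powers of [w] and [z]. *)
pose f g : 'F_p := ((chi w + l g) * (chi w + l g))%R.
have difE x g : x \in G -> g \in G ->
    dif f x g = (- (2%:R * l x) * (chi w + l g) - l x * l x)%R.
  by move=> xG gG; rewrite /dif /f lD //; ring.
have [|x xG|y yG hy] := realize frE (f := f).
- move=> e g eE gG; have eG := subsetP (normal_sub nsE) e eE.
  by rewrite /f lD // lE // add0r.
- have rw : rep (<[z]> <*> <[w]>)%G chi (fun g => chi (w ^ g)).
    by apply/repP; exists w.
  apply: rep_eq (rep_add frE (rep_scale frE (- (2%:R * l x))%R rw)
                             (rep_const frE (- (l x * l x))%R)) _.
  by move=> g gG; rewrite difE // jE.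
exists y => // x xG; have [xE hx] := hy x xG; split=> //.
  move=> xP; have lx := additive_on_Phi pr_p pG lD xP.
  apply: (frame_inj frE) => // g gG; rewrite hx // difE // lx conj1g.
  by rewrite (additive_on1 chiD); ring.
rewrite wl // => nt; have lx : l x != 0%R by apply: contraNneq nt => ->; rewrite expg0.
(* A power of [z] would represent a constant; comparing the values at [x] and at 1 would give
   [2 * l x * l x = 0]. *)
apply/negP=> /cycle_z[c ec].
have := hx x xG; have := hx 1 (group1 G); rewrite !difE // ec !(frame_zX frE) //.
rewrite (additive_on1 lD) => -> /eqP; rewrite -subr_eq0 => /eqP e.
have : (2%:R * l x * l x)%R == 0%R by apply/eqP; rewrite -e; ring.
by apply/negP; rewrite -mulrA mulf2_neq0 // mulf_neq0.
Qed.

(** It suffices that [Z2] is abelian, since its centralizer is Phi(G). If [w] with [w ^+ p = 1] did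
    not commute with [t], the element realizing the square attached to [w] would have a commutator
    with [t] outside [<[z]>]; [fix_order] reduces every pair to this case. *)
Lemma Z2_sub_Phi : Z2 \subset 'Phi(G).
Proof.
have main w t : w \in Z2 -> w ^+ p = 1 -> t \in Z2 -> [~ w, t] != 1 -> False.
  move=> wZ wp tZ nt; have [tG tz] := Z2P t tZ.
  have [y yG /(_ t tG)[_ _ /(_ nt)]] := square_realize wZ wp.
  by rewrite tz.
apply/subsetP=> x xZ; have [xG xz] := Z2P x xZ; rewrite -cent_Z2 inE xG /=.
apply/centP=> y yZ; have [yG yz] := Z2P y yZ; apply/commgP/negP=> /negP nt.
have [xZp yZp] := (Z2_p xZ, Z2_p yZ).
case: (fix_order pr_p odd_p pG cZ xG yG (cycle_zZ (xz _ yG)) (cycle_zp (xz _ yG)) xZp yZp).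
  case=> u uZ xu; apply: (main (x * u^-1) y) => //.
    by rewrite groupM // groupV center_Z2.
  have uVZ : u^-1 \in 'Z(G) by rewrite groupV.
  rewrite Z2_commM //; last by case/centerP: uVZ.
  by rewrite (commute_commg (centerC uVZ yG)) mulg1.
case=> k yk; apply: (main (y * x ^- k) x) => //; first by rewrite groupM // groupV groupX.
have xkx : commute (x ^- k) x by apply/commute_sym/commuteV/commuteX.
rewrite Z2_commM ?groupV ?groupX // (commute_commg xkx) mulg1.
by rewrite -invg_comm eq_invg1.
Qed.

(** * Quadratic functions *)

(** [N] stands for the subgroup generated by ['L_3(G)] and the p-th powers. *)
Variable N : {group gT}.
Hypotheses (nsNG : N <| G) (sNPhi : N \subset 'Phi(G)).
Hypothesis Nexp : forall g, g \in G -> g ^+ p \in N.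
Hypothesis Ncen : forall f g, f \in 'Phi(G) -> g \in G -> [~ f, g] \in N.
Hypothesis PhiGN : 'Phi(G) = G^`(1) <*> N.
Hypothesis nCN : ~~ ('C_G(N) \subset N).

Let sPhiG : 'Phi(G) \subset G. Proof. exact: Phi_sub. Qed.

Lemma Z2_Phi x : x \in Z2 -> x \in 'Phi(G).
Proof. exact: (subsetP Z2_sub_Phi). Qed.

Lemma Phi_Z2_commute f x : f \in 'Phi(G) -> x \in Z2 -> commute f x.
Proof. by rewrite -cent_Z2 => /setIP[_ /centP fC] /fC. Qed.

Lemma cent_Z2_Phi x : x \in G -> (forall y, y \in Z2 -> commute x y) -> x \in 'Phi(G).
Proof. by move=> xG xC; rewrite -cent_Z2 inE xG; apply/centP. Qed.

Lemma cent_Phi_sub : 'C_G('Phi(G)) \subset 'Phi(G).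
Proof. by rewrite -{2}cent_Z2 setIS // centS // Z2_sub_Phi. Qed.

Lemma cent_N_commute x y : x \in 'C(N) -> y \in N -> commute x y.
Proof. by move=> /centP xC /xC. Qed.

(** If [N] were trivial, Phi(G) and with it [Z2] would be central; then [G] = C_G(Z2) = Phi(G) would
    be abelian. *)
Lemma z_in_N : z \in N.
Proof.
apply: z_in_normal => //; apply: contra nabG => /eqP N1.
have PhiZ : 'Phi(G) \subset 'Z(G).
  apply/subsetP=> f fP; apply/centerP; split=> [|g gG]; first exact: (subsetP sPhiG).
  by apply/commgP; have := Ncen fP gG; rewrite N1 inE.
rewrite -(_ : 'Phi(G) = G); first by apply: abelianS PhiZ (center_abelian G).
apply/eqP; rewrite eqEsubset sPhiG; apply/subsetP=> g gG; apply: cent_Z2_Phi => // y yZ.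
by apply/commute_sym/centerC => //; rewrite (subsetP PhiZ) ?Z2_Phi.
Qed.

(** For noncentral [w], the element [y] realizing its square centralizes Phi(G), hence lies in
    Phi(G), so [[~ x, y]] is in [N]. Being in [<[z]> <*> <[w]>] but outside [<[z]>], it makes [N]
    meet [<[w]>]. *)
Lemma Z2_p1_N w : w \in Z2 -> w ^+ p = 1 -> w \in N.
Proof.
move=> wZ wp; have [wG wz] := Z2P w wZ.
have [-> // | w1] := eqVneq w 1.
have ow : #[w] = p by apply: nt_prime_order.
have [wc | ] := boolP (w \in 'Z(G)).
  have zw : z \in <[w]>.
    apply: (@z_in_normal <[w]>%G); last by rewrite cycle_eq1.
    by rewrite sub_center_normal // cycle_subG.
  have ezw : <[z]> = <[w]> by apply/eqP; rewrite eqEcard cycle_subG zw -!orderE oz ow /=.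
  by rewrite -cycle_subG -ezw cycle_subG z_in_N.
move=> wnc; have [x xG nt] : exists2 x, x \in G & [~ w, x] != 1.
  apply/exists_inP; apply: contraR wnc => /exists_inPn h.
  by apply/centerP; split=> // x xG; apply/commgP; have := h x xG; rewrite negbK.
have [y yG hy] := square_realize wZ wp.
have yP : y \in 'Phi(G).
  apply: (subsetP cent_Phi_sub); rewrite inE yG; apply/centP=> f fP.
  have fG := subsetP sPhiG f fP; have [_ /(_ fP) fy _] := hy f fG.
  by apply/commute_sym/commgP/eqP.
have [xyE _ /(_ nt) xyz] := hy x xG.
have xyN : [~ x, y] \in N by rewrite -groupV invg_comm Ncen.
have : N :&: <[w]> != 1.
  move: xyE; rewrite norm_joinEr; last first.
    by rewrite cycle_subG (subsetP (normal_norm (_ : <[z]> <| G))) // sub_center_normal ?cycle_subG.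
  case/mulsgP=> a b az bw e; apply: contraNneq xyz => tiN.
  suff: b \in N :&: <[w]> by rewrite tiN e inE => /eqP ->; rewrite mulg1.
  rewrite inE bw andbT -(mulKg a b) -e groupM ?groupV //.
  by apply: subsetP az; rewrite cycle_subG z_in_N.
rewrite setIC => /prime_meetG; rewrite -orderE ow => /(_ pr_p).
by rewrite cycle_subG.
Qed.

(** An element of C_G(N) outside both [N] and Phi(G) fails to commute with some [x] in [Z2]. This
    [x] centralizes [N] because [N] is in Phi(G), and it is outside [N] because the given element
    centralizes [N]. *)
Lemma exists_c : exists c, [/\ c \in 'Phi(G), c \in 'C(N) & c \notin N].
Proof.
have [c /setIP[cG cC] cN] := subsetPn nCN.
have [cP | cP] := boolP (c \in 'Phi(G)); first by exists c.
have [x xZ ntx] : exists2 x, x \in Z2 & [~ c, x] != 1.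
  apply/exists_inP; apply: contraR cP => /exists_inPn h.
  by apply: cent_Z2_Phi => // y yZ; apply/commgP; have := h y yZ; rewrite negbK.
exists x; split; first exact: Z2_Phi.
  by apply/centP=> n nN; apply/commute_sym/Phi_Z2_commute => //; apply: (subsetP sNPhi).
by apply: contra ntx => xN; apply/commgP/(cent_N_commute cC).
Qed.

(** * Invariant functions modulo the represented ones *)

Section Functional.

Variables (Psi : {group gT}) (chi : gT -> 'F_p).
Hypotheses (nsPsi : Psi <| G) (sPhiPsi : 'Phi(G) \subset Psi).

(** Centralizing [Psi] makes the represented functions invariant under left translation by [Psi]. *)
Definition E0 := 'Ohm_1('C_G(Psi))%G.

Let sCPhi : 'C_G(Psi) \subset 'Phi(G).
Proof. by apply: subset_trans cent_Phi_sub; rewrite setIS // centS. Qed.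

Lemma cent_Psi_abelian : abelian 'C_G(Psi).
Proof. by rewrite /abelian subIset // centS ?orbT //; apply: subset_trans sCPhi _. Qed.

Lemma E0P e : reflect (e \in 'C_G(Psi) /\ e ^+ p = 1) (e \in E0).
Proof.
have pC : p.-group 'C_G(Psi) by apply: pgroupS pG; apply: subsetIl.
rewrite /= (OhmEabelian pC) ?expn1; last exact: abelianS (Ohm_sub _ _) cent_Psi_abelian.
by rewrite !inE; apply: (iffP andP) => [] [-> /eqP].
Qed.

Lemma E0_facts : [/\ E0 <| G, p.-abelem E0 & z \in E0].
Proof.
have nsC : 'C_G(Psi) <| G by rewrite /normal subsetIl normsI ?normG ?norms_cent ?normal_norm.
split; first exact: gFnormal_trans.
  apply: Ohm1_abelem cent_Psi_abelian; apply: pgroupS pG; exact: subsetIl.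
apply/E0P; split; last exact: zp.
by rewrite inE zG; apply/centP=> t tP; apply: zC; apply: (subsetP (normal_sub nsPsi)).
Qed.

Hypothesis frE0 : frame E0 chi.

(* The functions whose class spans the socle of the quotient of the space of
   Psi-invariant functions by the represented ones. *)
Definition Sp (f : gT -> 'F_p) :=
  [forall t in Psi, [forall g in G, f (t * g)%g == f g]] &&
  [forall x in G, rep E0 chi (dif f x)].

Lemma SpP (f : gT -> 'F_p) :
  reflect ((forall t g, t \in Psi -> g \in G -> f (t * g)%g = f g)
           /\ (forall x, x \in G -> rep E0 chi (dif f x))) (Sp f).
Proof.
apply: (iffP andP) => [] [h1 h2]; split.
- by move=> t g tP gG; apply/eqP; apply: (forall_inP (forall_inP h1 t tP)).
- exact: (forall_inP h2).
- by apply/forall_inP=> t tP; apply/forall_inP=> g gG; apply/eqP/h1.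
- exact/forall_inP.
Qed.

Let sPsiG : Psi \subset G. Proof. exact: normal_sub. Qed.

Lemma Sp_eq f1 f2 : Sp f1 -> {in G, f1 =1 f2} -> Sp f2.
Proof.
move=> /SpP[h1 h2] e; apply/SpP; split.
  by move=> t g tP gG; rewrite -!e ?groupM ?h1 // (subsetP sPsiG).
by move=> x xG; apply: rep_eq (h2 x xG) _ => g gG; rewrite /dif !e ?groupM.
Qed.

Lemma Sp_add f1 f2 : Sp f1 -> Sp f2 -> Sp (fun g => f1 g + f2 g)%R.
Proof.
move=> /SpP[h1 h2] /SpP[k1 k2]; apply/SpP; split.
  by move=> t g tP gG; rewrite h1 ?k1.
move=> x xG; apply: rep_eq (rep_add frE0 (h2 x xG) (k2 x xG)) _ => g gG.
by rewrite /dif; ring.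
Qed.

Lemma Sp_scale c f : Sp f -> Sp (fun g => c * f g)%R.
Proof.
move=> /SpP[h1 h2]; apply/SpP; split; first by move=> t g tP gG; rewrite h1.
move=> x xG; apply: rep_eq (rep_scale frE0 c (h2 x xG)) _ => g gG.
by rewrite /dif; ring.
Qed.

Lemma rep_Sp f : rep E0 chi f -> Sp f.
Proof.
move=> rf; have /repP[e eE ef] := rf; have [/setIP[eG eC] _] := E0P e eE.
apply/SpP; split=> [t g tP gG|x xG].
  have tG := subsetP sPsiG t tP.
  by rewrite -!ef ?groupM // conjgM (conjgE e t) (centP eC t tP) mulKg.
apply: rep_eq (rep_add frE0 rf (rep_scale frE0 (- 1)%R (_ : rep _ _ (fun g => f (x * g)%g)))) _.
  apply/repP; exists (e ^ x); first exact: (frameJ frE0).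
  by move=> g gG; rewrite -conjgM ef ?groupM.
by move=> g gG; rewrite /dif mulN1r.
Qed.

Definition realizes y (f : gT -> 'F_p) :=
  y \in 'C_G(Psi) /\ forall x, x \in G ->
    [~ x, y] \in E0 /\ forall g, g \in G -> chi ([~ x, y] ^ g) = dif f x g.

(** [E0] lies in [Psi], so [f] is invariant enough to be realized; its differences along [Psi]
    vanish, so [y] centralizes [Psi]. *)
Lemma Sp_realize f : Sp f -> exists y, realizes y f.
Proof.
move=> /SpP[h1 h2]; have [||y yG hy] := realize frE0 (f := f) => //.
  move=> e g eE gG; apply: h1 => //; apply: (subsetP sPhiPsi); apply: (subsetP sCPhi).
  by have [] := E0P e eE.
exists y; split=> //; rewrite inE yG; apply/centP=> t tP.
have tG := subsetP sPsiG t tP; have [tyE hty] := hy t tG.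
apply/commute_sym/commgP/eqP/(frame_inj frE0) => // g gG.
have [_ _ _ chiD _] := frE0.
by rewrite hty // /dif h1 // subrr conj1g (additive_on1 chiD).
Qed.

Lemma realizes_p y f : realizes y f -> y ^+ p \in 'Z(G).
Proof.
move=> [/setIP[yG yC] hy]; apply/centerP; split=> [|x xG]; first by rewrite groupX.
have [xyE _] := hy x xG; have [xyC xyp] := E0P _ xyE.
have yCG : y \in 'C_G(Psi) by rewrite inE yG.
apply/commute_sym/commgP; rewrite commgX ?xyp //.
by apply: (centsP cent_Psi_abelian).
Qed.

Lemma realizes_combine y1 y2 f1 f2 (c : 'F_p) :
  realizes y1 f1 -> realizes y2 f2 ->
  realizes (y1 * y2 ^+ c) (fun g => f1 g + c * f2 g)%R.
Proof.
move=> [y1C h1] [y2C h2]; split; first by rewrite groupM ?groupX.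
have [_ _ _ chiD _] := frE0.
move=> x xG; have [x1E e1] := h1 x xG; have [x2E e2] := h2 x xG.
have inC e : e \in E0 -> e \in 'C_G(Psi) by case/E0P.
have cC a b : a \in 'C_G(Psi) -> b \in 'C_G(Psi) -> commute a b.
  by move=> aC bC; apply: (centsP cent_Psi_abelian).
have x2c : [~ x, y2 ^+ c] = [~ x, y2] ^+ c by rewrite commgX //; apply: cC => //; apply: inC.
have -> : [~ x, y1 * y2 ^+ c] = [~ x, y2] ^+ c * [~ x, y1].
  by rewrite commgMJ x2c conjgE (cC _ _ (inC _ x1E) (groupX _ y2C)) mulKg.
split=> [|g gG]; first by rewrite groupM ?groupX.
have x2X : [~ x, y2] ^+ c \in E0 by rewrite groupX.
rewrite conjMg (chiD _ _ (frameJ frE0 x2X gG) (frameJ frE0 x1E gG)) e1 //.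
by rewrite conjXg (additive_onXF _ chiD) ?(frameJ frE0) // e2 // /dif; ring.
Qed.

Lemma realizes_central y f w : realizes y f -> w \in 'Z(G) -> realizes (y * w) f.
Proof.
move=> [yC hy] wZ; have /centerP[wG wC] := wZ; split.
  rewrite groupM // inE wG; apply/centP=> t tP; apply: wC; exact: (subsetP sPsiG).
move=> x xG; suff -> : [~ x, y * w] = [~ x, y] by apply: hy.
by rewrite commgMJ (commute_commg (commute_sym (wC x xG))) mul1g conjgE -wC ?mulKg // groupR //; case/setIP: yC.
Qed.

(** An element [y] with [y ^+ p = 1] is in [E0], and its own function has the same differences as
    [f], so the two differ by a constant. *)
Lemma realizes_rep y f : realizes y f -> y ^+ p = 1 -> rep E0 chi f.
Proof.
move=> [yC hy] yp; have yE : y \in E0 by apply/E0P.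
have [_ _ _ chiD _] := frE0.
have ry : rep E0 chi (fun g => chi (y ^ g)) by apply/repP; exists y.
apply: rep_eq (rep_add frE0 ry (rep_const frE0 (f 1%g - chi y)%R)) _ => g gG.
have [gyE /(_ 1 (group1 G))] := hy g gG; rewrite conjg1 /dif mulg1.
have -> : [~ g, y] = (y ^ g)^-1 * y by rewrite commgEr conjVg.
have yg := frameJ frE0 yE gG; have ygV : (y ^ g)^-1 \in E0 by rewrite groupV.
by rewrite (chiD _ _ ygV yE) (additive_onV chiD) // => e; rewrite -[f g](subKr (f 1%g)) -e; ring.
Qed.

(* [y ^ p] is central for any [y] realizing [f], and central p-th powers can be
   absorbed, so cyclicity of Z(G) bounds the codimension by 1. *)
Lemma Sp_codim1 f0 f : Sp f0 -> ~~ rep E0 chi f0 -> Sp f ->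
  exists c : 'F_p, rep E0 chi (fun g => f g + c * f0 g)%R.
Proof.
move=> Sf0 nf0 Sf; have [y0 r0] := Sp_realize Sf0; have [y r] := Sp_realize Sf.
have pZ : p.-group 'Z(G) by apply: pgroupS pG; apply: center_sub.
case: (cyclic_pgroup_root pr_p pZ cZ (realizes_p r0) (realizes_p r)) => [[u uZ yu]|[k yk]].
  case/negP: nf0; have uVZ : u^-1 \in 'Z(G) by rewrite groupV.
  have /centerP[uG uC] := uVZ; have [/setIP[y0G _] _] := r0.
  apply: (realizes_rep (realizes_central r0 uVZ)).
  by rewrite expgMn ?expgVn ?yu ?mulgV //; apply/commute_sym/uC.
(* As natural numbers [k + c] is a multiple [p * m], so the p-th power of [y * y0 ^+ c] is cancelled
   by that of the central factor [(y0 ^+ p) ^- m]. *)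
pose c : 'F_p := (- k%:R)%R; exists c.
have [m km] : exists m, (k + c)%N = (p * m)%N.
  have : p %| k + c by rewrite /dvdn -(val_Fp_nat pr_p) natrD natr_Zp /c subrr.
  by case/dvdnP=> m ->; exists m; rewrite mulnC.
have [yC _] := r; have [y0C _] := r0; have y0Z := realizes_p r0.
have wZ : (y0 ^+ p) ^- m \in 'Z(G) by rewrite groupV groupX.
have /centerP[_ wC] := wZ.
apply: (realizes_rep (realizes_central (realizes_combine c r r0) wZ)).
have [yG y0G] : y \in G /\ y0 \in G by case/setIP: yC; case/setIP: y0C.
rewrite expgMn; last by apply/commute_sym/wC; rewrite groupM ?groupX.
rewrite expgMn; last by apply: commuteX; apply: (centsP cent_Psi_abelian).
by rewrite yk expgVn -!expgM -expgD !(mulnC p) -mulnDl km mulnAC -!(mulnC p) !mulnA mulgV.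
Qed.

(** By [Sp_codim1] the quotient of [Sp] by the represented functions has dimension at most 1; [q] is
    a coordinate on it, or 0 if it is trivial. *)
Lemma quotient_functional : exists q : (gT -> 'F_p) -> 'F_p,
  [/\ forall f, Sp f -> (q f == 0%R) = rep E0 chi f,
      forall f1 f2, Sp f1 -> {in G, f1 =1 f2} -> q f1 = q f2,
      forall f1 f2, Sp f1 -> Sp f2 -> q (fun g => f1 g + f2 g)%R = (q f1 + q f2)%R &
      forall c f, Sp f -> q (fun g => c * f g)%R = (c * q f)%R].
Proof.
(* Finite functions are used so that an unrepresented one can be searched for. *)
have [f0 /andP[Sf0 nf0] | all_rep] := pickP [pred f : {ffun gT -> 'F_p} | Sp f && ~~ rep E0 chi f]; last first.
  exists (fun=> 0%R); split=> [f Sf|//|f1 f2 _ _|c f _]; rewrite ?addr0 ?mulr0 //.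
  rewrite eqxx; apply/esym.
  have := all_rep (finfun f); have e : {in G, f =1 finfun f} by move=> g _; rewrite ffunE.
  rewrite /= (Sp_eq Sf e) /= => /negbFE rf; apply: rep_eq rf _ => g gG.
  by rewrite ffunE.
pose q f := odflt 0%R [pick c : 'F_p | rep E0 chi (fun g => f g + (- c) * f0 g)%R].
have qP f : Sp f -> rep E0 chi (fun g => f g + (- q f) * f0 g)%R.
  move=> Sf; rewrite /q; case: pickP => //= no.
  have [c rc] := Sp_codim1 Sf0 nf0 Sf; move: (no (- c)%R); rewrite /= => /negbT/negP[].
  by apply: rep_eq rc _ => g _; rewrite opprK.
have qu f c : Sp f -> rep E0 chi (fun g => f g + (- c) * f0 g)%R -> q f = c.
  move=> Sf rc; apply/eqP; rewrite -subr_eq0; apply: contraR nf0 => ne.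
  have := rep_add frE0 rc (rep_scale frE0 (- 1)%R (qP f Sf)).
  move/(rep_scale frE0 (q f - c)^-1%R) => r; apply: rep_eq r _ => g gG /=.
  by rewrite -[RHS](mulKf ne); ring.
exists q; split.
- move=> f Sf; apply/eqP/idP => [q0|rf].
    by apply: rep_eq (qP f Sf) _ => g gG; rewrite q0 oppr0 mul0r addr0.
  by apply: qu => //; apply: rep_eq rf _ => g gG; rewrite oppr0 mul0r addr0.
- move=> f1 f2 Sf1 e; apply: qu => //; apply: rep_eq (qP f2 _) _; first exact: Sp_eq e.
  by move=> g gG; rewrite e.
- move=> f1 f2 Sf1 Sf2; apply: qu; first exact: Sp_add.
  by apply: rep_eq (rep_add frE0 (qP _ Sf1) (qP _ Sf2)) _ => g gG; ring.
- move=> c f Sf; apply: qu; first exact: Sp_scale.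
  by apply: rep_eq (rep_scale frE0 c (qP _ Sf)) _ => g gG; ring.
Qed.

Definition hom_mod (l : gT -> 'F_p) := additive_on G l /\ forall t, t \in Psi -> l t = 0%R.

Lemma hom_mod_inv l t g : hom_mod l -> t \in Psi -> g \in G -> l (t * g)%g = l g.
Proof.
move=> [lD l0] tP gG; have tG := subsetP sPsiG t tP.
by rewrite (lD _ _ tG gG) (l0 _ tP) add0r.
Qed.

Lemma hom_mod_Sp l : hom_mod l -> Sp l.
Proof.
move=> hl; have [lD _] := hl; apply/SpP; split=> [t g tP gG|x xG].
  exact: hom_mod_inv.
by apply: rep_eq (rep_const frE0 (- l x)%R) _ => g gG; rewrite /dif lD //; ring.
Qed.

Lemma prod_Sp l m : hom_mod l -> hom_mod m -> rep E0 chi l -> rep E0 chi m ->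
  Sp (fun g => l g * m g)%R.
Proof.
move=> hl hm rl rm; have [[lD _] [mD _]] := (hl, hm); apply/SpP; split=> [t g tP gG|x xG].
  by rewrite !hom_mod_inv.
apply: rep_eq (rep_add frE0 (rep_const frE0 (- (l x * m x))%R)
  (rep_add frE0 (rep_scale frE0 (- l x)%R rm) (rep_scale frE0 (- m x)%R rl))) _ => g gG.
by rewrite /dif lD // mD //; ring.
Qed.

End Functional.

(** * Elements realizing quadratic functions *)

(** An affine function has constant differences, and constants are represented by powers of [z]. *)
Lemma affine_Z2 E chi e (l : gT -> 'F_p) (a : 'F_p) : frame E chi -> additive_on G l ->
    e \in E -> (forall g, g \in G -> chi (e ^ g)%g = a + l g)%R ->
  e \in Z2 /\ forall x, x \in G -> [~ e, x] = z ^+ l x.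
Proof.
move=> frE lD eE el; have [nsE _ zE chiD chiz] := frE.
have ex x : x \in G -> [~ e, x] = z ^+ l x.
  move=> xG; have exE := frameJ frE eE xG; have eVE := groupVr eE.
  apply: (frame_inj frE); [by rewrite commgEl; apply: groupM | by rewrite groupX |].
  move=> g gG; rewrite (frame_zX frE) // commgEl conjMg.
  rewrite (chiD _ _ (frameJ frE eVE gG) (frameJ frE exE gG)) conjVg.
  rewrite (additive_onV chiD) ?(frameJ frE) // -conjgM !el ?groupM // lD //; ring.
split=> //; apply/Z2P; split; first exact: (subsetP (normal_sub nsE)).
by move=> g gG; rewrite ex // mem_cycle.
Qed.

Lemma frameS E H chi : frame E chi -> H <| G -> H \subset E -> z \in H -> frame H chi.
Proof.
move=> [nsE abE zE chiD chiz] nsH sHE zH; split=> //; first exact: abelemS abE.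
by move=> x y xH yH; apply: chiD; apply: (subsetP sHE).
Qed.

(* The quadratic function with polarization [B], corrected so that all its
   differences are represented by elements of order p. *)
Lemma quadratic_function chi (phi : gT -> 'F_p) : frame (E0 'Phi(G)) chi ->
    additive_on 'Phi(G) phi -> (forall n, n \in N -> phi n = 0%R) ->
  exists j : gT -> 'F_p, exists a : gT -> 'F_p, exists l : gT -> gT -> 'F_p,
    (forall t g, t \in 'Phi(G) -> g \in G -> j (t * g)%g = phi t + j g)%R /\
    (forall x, x \in G -> [/\ additive_on G (l x), rep (E0 'Phi(G)) chi (l x)
      & forall g, g \in G -> dif j x g = a x + l x g]%R).
Proof.
move=> frE phiD phiN; have nsP := Phi_normal G.
have PhiG t : t \in 'Phi(G) -> t \in G by apply: (subsetP sPhiG).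
have [q [qS qe qD qZ]] := quotient_functional nsP (subxx _) frE.
have phiR f g : f \in 'Phi(G) -> g \in G -> phi [~ f, g] = 0%R.
  by move=> fP gG; apply/phiN/Ncen.
have [|j0 [B [jB B1 B2 jphi]]] := biadditive_cocycle pr_p pG phiD phiR.
  by move=> g gG; apply/phiN/Nexp.
have homP l : additive_on G l -> hom_mod 'Phi(G) l.
  by move=> lD; split=> //; apply: additive_on_Phi lD.
have SB x : x \in G -> Sp 'Phi(G) chi (B x) by move=> xG; apply/hom_mod_Sp/homP/B1.
(* [Bt x] is the obstruction to representing the linear part of the difference of [j0] at [x]. *)
pose Bt x := q (B x).
have BtD : additive_on G Bt.
  move=> x y xG yG; rewrite /Bt -qD ?SB //; apply: qe; first by apply: SB; apply: groupM.
  by move=> g gG; apply: (B2 g gG).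
have B0 t g : t \in 'Phi(G) -> g \in G -> B t g = 0%R.
  by move=> tP gG; apply: (additive_on_Phi pr_p pG (B2 g gG)).
have j0t t g : t \in 'Phi(G) -> g \in G -> j0 (t * g)%g = (phi t + j0 g)%R.
  by move=> tP gG; rewrite (jB _ _ (PhiG t tP) gG) B0 // (jphi _ tP) addr0.
have [Bt0 | ] := boolP [forall x in G, Bt x == 0%R].
  exists j0, (fun x => - j0 x)%R, (fun x g => - 1 * B x g)%R; split=> // x xG; split.
  - by move=> g h gG hG; rewrite B1 //; ring.
  - by apply: (rep_scale frE); rewrite -qS ?SB //; apply: (forall_inP Bt0).
  - by move=> g gG; rewrite /dif jB //; ring.
case/forall_inPn=> x0 x0G nz.
have [ep [epD Sep qep]] : exists ep, [/\ additive_on G ep, Sp 'Phi(G) chi ep & q ep = 1%R].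
  have epD : additive_on G (fun g => (Bt x0)^-1 * B x0 g)%R.
    by move=> g h gG hG; rewrite B1 //; ring.
  exists (fun g => (Bt x0)^-1 * B x0 g)%R; split=> //; first exact/hom_mod_Sp/homP.
  by rewrite qZ ?SB // mulVf.
have SBt : Sp 'Phi(G) chi Bt by apply/hom_mod_Sp/homP.
(* Subtracting [Bt * ep] cancels the obstruction [Bt x] but creates [c * ep x], which adding [c / 2]
   times the square of [ep] cancels in turn. *)
pose c := q Bt; pose hc := (c / 2%:R)%R.
have hcE : (hc * 2%:R)%R = c by rewrite /hc mulfVK ?two_neq0.
have ep0 t : t \in 'Phi(G) -> ep t = 0%R by apply: (proj2 (homP _ epD)).
have Bt0 t : t \in 'Phi(G) -> Bt t = 0%R by apply: (proj2 (homP _ BtD)).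
pose l x g := ((- 1 * B x g + Bt x * ep g) + (ep x * Bt g + (- c * ep x) * ep g))%R.
exists (fun g => j0 g - Bt g * ep g + hc * (ep g * ep g))%R.
exists (fun x => - j0 x + Bt x * ep x - hc * (ep x * ep x))%R, l; split.
  move=> t g tP gG; have tG := PhiG t tP.
  by rewrite j0t // (BtD _ _ tG gG) (epD _ _ tG gG) (ep0 _ tP) (Bt0 _ tP); ring.
move=> x xG; split.
- by move=> g h gG hG; rewrite /l B1 // BtD // epD //; ring.
- have S1 := SB x xG; have Sadd := Sp_add frE; have Ssc := Sp_scale frE.
  rewrite -qS; last by apply: (Sadd); apply: (Sadd); apply: (Ssc).
  rewrite qD; [|by apply: (Sadd); apply: (Ssc)..].
  rewrite !qD; [|by apply: (Ssc)..].
  by rewrite !qZ // qep -/c; apply/eqP; rewrite /Bt; ring.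
- move=> g gG; rewrite /dif jB // BtD // epD // /l.
  by rewrite -hcE; ring.
Qed.

(** [h] realizes the quadratic extension [j] of [phi]. The frame is cut down to [N], where [phi]
    vanishes, to make [j] invariant; by [affine_Z2] and [Z2_p1_N] the representing elements do lie
    in [N]. *)
Lemma polarized_element (phi : gT -> 'F_p) :
    additive_on 'Phi(G) phi -> (forall n, n \in N -> phi n = 0%R) ->
  exists2 h, h \in 'C_G(N) &
    (forall x, x \in G -> [/\ [~ x, h] \in Z2, [~ x, h] \in N & [~ x, h] ^+ p = 1]) /\
    (forall f, f \in 'Phi(G) -> [~ f, h] = z ^+ (- phi f)%R).
Proof.
move=> phiD phiN; have nsP := Phi_normal G.
have [nsE abE zE] := E0_facts nsP (subxx _).
have [chi frE] := frame_exists nsE abE zE.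
have [j [a [l [jt jl]]]] := quadratic_function frE phiD phiN.
pose EN := (E0 'Phi(G) :&: N)%G.
have frEN : frame EN chi.
  by apply: frameS frE _ (subsetIl _ _) _; [apply: normalI | rewrite inE zE z_in_N].
have inE0 e : e \in EN -> e \in E0 'Phi(G) /\ e \in N by case/setIP.
have [e g /inE0[_ eN] gG|x xG|h hG hh] := realize frEN (f := j).
- by rewrite jt ?phiN ?add0r //; apply: (subsetP sNPhi).
- have [lD /repP[e eE el] dl] := jl x xG.
  have [eZ _] := @affine_Z2 _ _ _ (l x) 0%R frE lD eE (fun g gG => etrans (el g gG) (esym (add0r _))).
  have ep : e ^+ p = 1 by have [] := E0P (subxx _) e eE.
  have rl : rep EN chi (l x) by apply/repP; exists e => //; rewrite inE eE Z2_p1_N.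
  by apply: rep_eq (rep_add frEN (rep_const frEN (a x)) rl) _ => g gG; rewrite dl.
have hf f : f \in 'Phi(G) -> [~ f, h] = z ^+ (- phi f)%R.
  move=> fP; have fG := subsetP sPhiG f fP; have [fE df] := hh f fG.
  apply: (frame_inj frEN) => //; first by rewrite groupX //; case: frEN.
  by move=> g gG; rewrite df // (frame_zX frEN) // /dif jt //; ring.
exists h.
  rewrite inE hG; apply/centP=> n nN; apply/commute_sym/commgP.
  by rewrite hf ?phiN ?oppr0 ?(subsetP sNPhi).
split=> // x xG; have [xE dx] := hh x xG; have [lD _ dl] := jl x xG.
have [xE0 xN] := inE0 _ xE; split=> //; last by have [] := E0P (subxx _) _ xE0.
by have [] := @affine_Z2 _ _ _ (l x) (a x) frE lD xE0 (fun g gG => etrans (dx g gG) (dl g gG)).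
Qed.

(* Contains the elements realizing quadratic functions. *)
Definition quad := [set h in 'C_G(N) |
  [forall x in G, [&& [~ x, h] \in Z2, [~ x, h] \in N & [~ x, h] ^+ p == 1]]].

Lemma quadP h : reflect (h \in 'C_G(N) /\
    forall x, x \in G -> [/\ [~ x, h] \in Z2, [~ x, h] \in N & [~ x, h] ^+ p = 1])
  (h \in quad).
Proof.
rewrite [h \in quad]in_set; apply: (iffP andP) => [] [hC hx]; split=> //.
  by move=> x xG; have /and3P[? ? /eqP] := forall_inP hx x xG.
by apply/forall_inP=> x xG; have [-> -> ->] := hx x xG; rewrite eqxx.
Qed.

Lemma quad_group_set : group_set quad.
Proof.
apply/group_setP; split.
  apply/quadP; split=> // x _; by rewrite commg1; split; rewrite ?expg1n ?group1.
move=> h1 h2 /quadP[h1C h1x] /quadP[h2C h2x]; apply/quadP; split; first exact: groupM.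
move=> x xG; have [[Z1 N1 p1] [ZZ2 N2 p2]] := (h1x x xG, h2x x xG).
have [_ h2CN] := setIP h2C.
have -> : [~ x, h1 * h2] = [~ x, h2] * [~ x, h1].
  by rewrite commgMJ conjgE -(cent_N_commute h2CN N1) mulKg.
split; [exact: (groupM (G := Z2_group)) | exact: groupM |].
by rewrite expgMn ?p1 ?p2 ?mulg1 //; apply: Phi_Z2_commute => //; apply: Z2_Phi.
Qed.
Canonical quad_group := Group quad_group_set.

Lemma Z2_cent_N x : x \in Z2 -> x \in 'C_G(N).
Proof.
move=> xZ; have [xG _] := Z2P x xZ; rewrite inE xG; apply/centP=> n nN.
by apply/commute_sym/Phi_Z2_commute => //; apply: (subsetP sNPhi).
Qed.

Lemma Z2_quad x : x \in Z2 -> x \in quad.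
Proof.
move=> xZ; apply/quadP; split; first exact: Z2_cent_N.
move=> g gG; have [xG xz] := Z2P x xZ; have gz : [~ g, x] \in <[z]>.
  by rewrite -invg_comm groupV xz.
split; [exact/center_Z2/cycle_zZ | | exact: cycle_zp].
by apply: subsetP gz; rewrite cycle_subG z_in_N.
Qed.

Lemma quad_p h : h \in quad -> h ^+ p \in 'Z(G).
Proof.
case/quadP=> /setIP[hG hC] hx; apply/centerP; split=> [|x xG]; first by rewrite groupX.
have [_ xN xp] := hx x xG; apply/commute_sym/commgP.
by rewrite commgX ?xp //; apply: (cent_N_commute hC xN).
Qed.

Lemma abelem_Phi_quotient (K : {group gT}) : N \subset K -> K <| G -> p.-abelem ('Phi(G) / K).
Proof.
move=> sNK nsK; have nK := normal_norm nsK; apply/abelemP=> //; split.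
  apply: sub_der1_abelian; rewrite gen_subG.
  apply/subsetP=> _ /imset2P[x y xP yP ->]; apply: (subsetP sNK); apply: Ncen => //.
  exact: (subsetP sPhiG).
move=> _ /morphimP[x nx xP ->]; rewrite -morphX //= coset_id //.
by apply: (subsetP sNK); apply: Nexp; apply: (subsetP sPhiG).
Qed.

Lemma polarized_quad (K : {group gT}) c :
    N \subset K -> K <| G -> K \subset 'Phi(G) -> c \in 'Phi(G) -> c \notin K ->
  exists2 h, h \in quad & [/\ forall f, f \in 'Phi(G) -> [~ f, h] \in <[z]>,
    forall k, k \in K -> commute k h & [~ c, h] != 1].
Proof.
move=> sNK nsK sKP cP cK.
have nsKP : K <| 'Phi(G) by apply: normalS nsK.
have [phi [phiD phiK phic]] := functional pr_p nsKP (abelem_Phi_quotient sNK nsK) cP cK.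
have [|h hC [hx hf]] := polarized_element phiD; first by move=> n /(subsetP sNK)/phiK.
exists h; first exact/quadP.
split=> [f fP|k kK|]; first by rewrite hf // mem_cycle.
  by apply/commgP; rewrite hf ?(subsetP sKP) // phiK // oppr0.
rewrite hf // phic; apply/eqP=> e; have : (- 1 : 'F_p)%R = 0%R by apply: zXF_inj; rewrite expg0.
by move/eqP; rewrite oppr_eq0 oner_eq0.
Qed.

(** * The pair [h], [t] *)

(** Either alternative forces [[~ t, y]] into [<[z]>] for the [y] realizing the cubic function; in
    the first one such a [y] will lie in Phi(G). *)
Definition final_pair h t :=
  [/\ h \in quad, h ^+ p = 1, t \in 'Phi(G), [~ h, t] \in <[z]> & [~ h, t] != 1] /\
  ((h \in 'Phi(G) /\ forall y, y \in 'Phi(G) -> [~ t, y] \in <[z]>) \/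
   t \in Z2).

Lemma commMc u v t : t \in G -> v \in G -> [~ u, t] \in 'Z(G) -> commute v t -> [~ u * v, t] = [~ u, t].
Proof. by move=> tG vG uZ vt; rewrite commMgJ centerJ // (commute_commg vt) mulg1. Qed.

Lemma invg_comm_z x y : [~ x, y] \in <[z]> -> [~ y, x] \in <[z]>.
Proof. by rewrite -invg_comm groupV. Qed.

Lemma invg_comm_nt (x y : gT) : [~ x, y] != 1 -> [~ y, x] != 1.
Proof. by rewrite -invg_comm eq_invg1. Qed.

Lemma final_pair_exists : exists h t, final_pair h t.
Proof.
pose NZ := (N <*> Z2)%G.
have sNNZ : N \subset NZ by apply: joing_subl.
have nsNZ : NZ <| G by apply: normalY => //; apply: Z2_normal.
have sNZP : NZ \subset 'Phi(G) by rewrite join_subG sNPhi Z2_sub_Phi.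
have sZNZ : Z2 \subset NZ by apply: joing_subr.
have NZE x : x \in NZ -> exists n k, [/\ n \in N, k \in Z2 & x = n * k].
  rewrite /= norm_joinEr; first by case/mulsgP=> n k nN kZ ->; exists n, k.
  by apply: subset_trans (normal_norm nsNG); apply: normal_sub Z2_normal.
have PhiG f : f \in 'Phi(G) -> f \in G by apply: (subsetP sPhiG).
have Z2G x : x \in Z2 -> x \in G by case/Z2P.
have quadG x : x \in quad -> x \in G by case/quadP=> /setIP[].
have [c [cP cC cN]] := exists_c.
(* Outside [NZ], duality applied to [c] gives [h] in Phi(G), which is again outside [NZ] because [c]
   commutes with [NZ]. Duality applied to [h] gives [h'], and one of the two is corrected to order
   p. *)
have [cNZ | cNZ] := boolP (c \in NZ); last first.
  have inPhi h : h \in quad -> (forall k, k \in NZ -> commute k h) -> h \in 'Phi(G).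
    move=> hq hk; apply: cent_Z2_Phi; first exact: quadG.
    by move=> y yZ; apply/commute_sym/hk; apply: (subsetP sZNZ).
  have [h hq [hz hNZ hc]] := polarized_quad sNNZ nsNZ sNZP cP cNZ.
  have hP := inPhi h hq hNZ; have hG := PhiG h hP.
  have hnNZ : h \notin NZ.
    apply: contra hc => /NZE[n [k [nN kZ ->]]]; apply/commgP/commuteM.
      exact: (cent_N_commute cC nN).
    exact: Phi_Z2_commute.
  have [h' hq' [hz' hNZ' hc']] := polarized_quad sNNZ nsNZ sNZP hP hnNZ.
  have hP' := inPhi h' hq' hNZ'; have hG' := PhiG h' hP'.
  have hh' := hz' h hP.
  case: (fix_order pr_p odd_p pG cZ hG hG' (cycle_zZ hh') (cycle_zp hh') (quad_p hq) (quad_p hq')).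
    case=> w wZ hp; have wVZ : w^-1 \in 'Z(G) by rewrite groupV.
    have e : [~ h * w^-1, h'] = [~ h, h'].
      apply: commMc (cycle_zZ hh') _ => //; last exact: centerC.
      by case/centerP: wVZ.
    have wVq : w^-1 \in quad by apply/Z2_quad/center_Z2.
    exists (h * w^-1), h'; split; first by rewrite /= e; split=> //; apply: groupM.
    left; split; first by apply: groupM => //; apply/Z2_Phi/center_Z2.
    by move=> y yP; apply/invg_comm_z/hz'.
  case=> k hp; have h'h := invg_comm_z hh'.
  have e : [~ h' * h ^- k, h] = [~ h', h].
    apply: commMc (cycle_zZ h'h) _ => //; first by rewrite groupV groupX.
    by apply/commute_sym/commuteV/commuteX.
  exists (h' * h ^- k), h; split.
    rewrite /= e; split=> //; last exact: invg_comm_nt.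
    by apply: groupM => //; rewrite groupV groupX.
  left; split; first by apply: groupM => //; rewrite groupV groupX.
  by move=> y yP; apply/invg_comm_z/hz.
(* Here the part [x0] of [c] in [Z2] takes the role of [t]. It has no central correction to order p,
   since the corrected element would be in [N] and commute with [h]; so [fix_order] has to correct
   [h]. *)
have [n [x0 [nN xZ cE]]] := NZE c cNZ.
have x0N : x0 \notin N by apply: contra cN => xN; rewrite cE groupM.
have x0P := Z2_Phi xZ; have x0G := PhiG x0 x0P.
have [h hq [hz hN hx]] := polarized_quad (subxx _) nsNG sNPhi x0P x0N.
have hG := quadG h hq; have x0h := hz x0 x0P; have hx0 := invg_comm_z x0h.
have no_root w : w \in 'Z(G) -> (x0 * w^-1) ^+ p = 1 -> False.
  move=> wZ xp; have wVZ : w^-1 \in 'Z(G) by rewrite groupV.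
  have xwN : x0 * w^-1 \in N by apply: Z2_p1_N => //; apply: groupM => //; apply: center_Z2.
  case/negP: hx; apply/commgP; rewrite -(mulgKV w x0).
  by apply/commute_sym/commuteM; apply/commute_sym; [apply: hN | apply: centerC].
case: (fix_order pr_p odd_p pG cZ x0G hG (cycle_zZ x0h) (cycle_zp x0h) (Z2_p xZ) (quad_p hq)).
  by case=> w wZ /(no_root w wZ).
case=> k hp; have xkZ : x0 ^- k \in Z2 by rewrite groupV groupX.
have e : [~ h * x0 ^- k, x0] = [~ h, x0].
  apply: commMc (cycle_zZ hx0) _ => //; first exact: Z2G.
  by apply/commute_sym/commuteV/commuteX.
have hnq : h * x0 ^- k \in quad by apply: groupM => //; apply: Z2_quad.
exists (h * x0 ^- k), x0; split; last by right.
by rewrite /= e; split=> //; apply: invg_comm_nt.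
Qed.

(** * Cubic functions *)

Section Final.

Variables h t : gT.
Hypothesis ht : final_pair h t.

Let hq : h \in quad. Proof. by case: ht => [[]]. Qed.
Let hp : h ^+ p = 1. Proof. by case: ht => [[]]. Qed.
Let tP : t \in 'Phi(G). Proof. by case: ht => [[]]. Qed.
Let ht_z : [~ h, t] \in <[z]>. Proof. by case: ht => [[]]. Qed.
Let ht_nt : [~ h, t] != 1. Proof. by case: ht => [[]]. Qed.
Let hG : h \in G. Proof. by case/quadP: hq => /setIP[]. Qed.
Let hCN : h \in 'C(N). Proof. by case/quadP: hq => /setIP[]. Qed.

Let PhiG f : f \in 'Phi(G) -> f \in G.
Proof. exact: (subsetP sPhiG). Qed.

Let hR x : x \in G -> [/\ [~ h, x] \in Z2, [~ h, x] \in N & [~ h, x] ^+ p = 1].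
Proof.
move=> xG; have [_ /(_ x xG)[Z Nx px]] := quadP _ hq.
by rewrite -invg_comm expgVn px invg1 !groupV.
Qed.

Let Psi := ('Phi(G) <*> <[h]>)%G.

Let sPhiPsi : 'Phi(G) \subset Psi. Proof. exact: joing_subl. Qed.
Let hPsi : h \in Psi. Proof. by rewrite (subsetP (joing_subr _ _)) ?cycle_id. Qed.

Let nsPsi : Psi <| G.
Proof.
apply: normal_join_cycle => //; first exact: Phi_normal.
by move=> g gG; have [/Z2_Phi] := hR gG.
Qed.

Let hom_modI l : additive_on G l -> l h = 0%R -> hom_mod Psi l.
Proof.
move=> lD lh; split=> // u.
rewrite /= norm_joinEr; last by rewrite cycle_subG (subsetP (gFnorm _ _)).
case/mulsgP=> f k fP /cycleP[i ->] ->.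
by rewrite (lD _ _ (PhiG fP) (groupX i hG)) (additive_on_Phi pr_p pG lD fP) (additive_onX _ lD) // lh mul0rn addr0.
Qed.

Let EP e : reflect (e \in 'C_G(Psi) /\ e ^+ p = 1) (e \in E0 Psi).
Proof. exact: E0P. Qed.

Let Z2_E0 v : v \in Z2 -> v \in N -> v ^+ p = 1 -> v \in E0 Psi.
Proof.
move=> vZ vN vp; apply/EP; split=> //; have [vG _] := Z2P v vZ; rewrite inE vG /=.
rewrite -sub_cent1 join_subG cycle_subG sub_cent1.
apply/andP; split; last exact/cent1P/(cent_N_commute hCN vN).
by apply/centP=> f fP; apply/commute_sym/Phi_Z2_commute.
Qed.

(** Adjoining [h] to [E0 Psi] makes [g |-> chi (h ^ g)] a represented function. *)
Let E := (E0 Psi <*> <[h]>)%G.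

Let sE0E : E0 Psi \subset E. Proof. exact: joing_subl. Qed.
Let hE : h \in E. Proof. by rewrite (subsetP (joing_subr _ _)) ?cycle_id. Qed.

Let chi_exists : exists chi, frame E chi.
Proof.
have [nsE0 abE0 zE0] := E0_facts nsPsi sPhiPsi.
apply: frame_exists; last exact: (subsetP sE0E).
  by apply: normal_join_cycle => // g gG; have [] := hR gG; apply: Z2_E0.
apply: abelem_join_cycle => //; apply/centP=> e /EP[/setIP[_ eC] _].
exact/commute_sym/(centP eC).
Qed.

Section Character.

Variable chi : gT -> 'F_p.
Hypothesis frE : frame E chi.

Let frE0 : frame (E0 Psi) chi.
Proof. by have [nsE0 _ zE0] := E0_facts nsPsi sPhiPsi; apply: frameS frE _ _ _. Qed.

Let chiD : additive_on E chi. Proof. by case: frE. Qed.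

(** [j] is the quadratic function represented by [h], with polarization [B]. *)
Let j g := chi (h ^ g).
Let b x := chi [~ h, x].
Let B x g := chi [~ [~ h, x], g].

Let cycle_zE u : u \in <[z]> -> u \in E.
Proof. by apply: subsetP; rewrite cycle_subG; case: frE. Qed.

Let RE x : x \in G -> [~ h, x] \in E.
Proof. by move=> /hR[Z Nx px]; apply: (subsetP sE0E); apply: Z2_E0. Qed.

Let RRz x g : x \in G -> g \in G -> [~ [~ h, x], g] \in <[z]>.
Proof. by move=> /hR[/Z2P[_ xz] _ _] gG; apply: xz. Qed.

Let jM x g : x \in G -> g \in G -> j (x * g)%g = (j g + b x + B x g)%R.
Proof.
move=> xG gG; have xE := RE xG; have gz := cycle_zE (RRz xG gG).
rewrite /j conjgM (conjg_mulR h x) conjMg (chiD (frameJ frE hE gG) (frameJ frE xE gG)).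
by rewrite (conjg_mulR [~ h, x]) (chiD xE gz) addrA.
Qed.

Let B1 x : x \in G -> additive_on G (B x).
Proof.
move=> xG g g' gG gG'; have [xZ _ _] := hR xG.
by rewrite /B Z2_commMr // chiD ?cycle_zE ?RRz.
Qed.

Let B2 g : g \in G -> additive_on G (B^~ g).
Proof.
move=> gG x y xG yG /=; have [[xZ _ _] [yZ _ _]] := (hR xG, hR yG).
have xyz := RRz xG yG; have [xG' _] := Z2P _ xZ; have xyZ := cycle_zZ xyz.
have cz : commute [~ [~ h, x], y] g by apply: centerC.
have [xyG _] := Z2P _ (center_Z2 xyZ).
rewrite /B commgMJ (conjg_mulR [~ h, x]) (Z2_commM yZ (groupM xG' xyG) gG).
rewrite (commMc gG xyG (cycle_zZ (RRz xG gG)) cz).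
by rewrite (chiD (cycle_zE (RRz yG gG)) (cycle_zE (RRz xG gG))) addrC.
Qed.

Let Bh g : g \in G -> B h g = 0%R.
Proof. by move=> gG; rewrite /B commgg comm1g (additive_on1 chiD). Qed.

Let BHh x : x \in G -> B x h = 0%R.
Proof.
move=> xG; have [_ xN _] := hR xG; rewrite /B (commute_commg _) ?(additive_on1 chiD) //.
exact/commute_sym/(cent_N_commute hCN).
Qed.

Let B1m x : x \in G -> hom_mod Psi (B x).
Proof. by move=> xG; apply: hom_modI; [apply: B1 | apply: BHh]. Qed.

Let B2m g : g \in G -> hom_mod Psi (B^~ g).
Proof. by move=> gG; apply: hom_modI; [apply: B2 | apply: Bh]. Qed.

Let Brep x : x \in G -> rep (E0 Psi) chi (B x).
Proof.
move=> xG; have [xZ xN xp] := hR xG; have xE := Z2_E0 xZ xN xp.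
have rx : rep (E0 Psi) chi (fun g => chi ([~ h, x] ^ g)) by apply/repP; exists [~ h, x].
apply: rep_eq (rep_add frE0 rx (rep_const frE0 (- b x)%R)) _ => g gG.
rewrite (conjg_mulR [~ h, x]) (chiD (RE xG)) ?cycle_zE ?RRz // /b /B; ring.
Qed.

Let rep_E f : rep (E0 Psi) chi f -> rep E chi f.
Proof. by move=> /repP[e eE ef]; apply/repP; exists e => //; apply: (subsetP sE0E). Qed.

(** At [t] the difference of [l * j + s] is a nonzero multiple of [l], because [[~ h, t] != 1]. It
    would be represented by [[~ t, y]], a power of [z], and so be constant, but [l] vanishes at 1
    and not at [g1]. *)
Let final_realization (l s : gT -> 'F_p) g1 : hom_mod Psi l ->
    (forall u g, u \in Psi -> g \in G -> s (u * g)%g = s g) ->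
    (forall x, x \in G -> rep E chi (dif (fun g => l g * j g + s g)%R x)) ->
  g1 \in G -> l g1 != 0%R -> False.
Proof.
move=> hl sP repF g1G lg1; have [lD l0] := hl.
have sEPsi : E \subset Psi.
  rewrite join_subG cycle_subG hPsi andbT; apply/subsetP=> e /EP[eC _].
  apply: (subsetP sPhiPsi); apply: (subsetP cent_Phi_sub).
  by apply: subsetP eC; rewrite setIS // centS.
have [e g eE gG|//|y yG hy] := realize frE (f := fun g => (l g * j g + s g)%R).
  have eP := subsetP sEPsi e eE; rewrite (hom_mod_inv nsPsi hl) // sP // /j conjgM.
  by rewrite (conjgE h e) (frameC frE hE eE) mulKg.
have difP u g : u \in 'Phi(G) -> g \in G ->
    dif (fun g => l g * j g + s g)%R u g = (- (l g * chi ([~ h, u] ^ g)%g))%R.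
  move=> uP gG; have uPsi := subsetP sPhiPsi u uP; have uG := PhiG uP.
  rewrite /dif (hom_mod_inv nsPsi hl) // sP // jM // (conjg_mulR [~ h, u]).
  by rewrite (chiD (RE uG)) ?cycle_zE ?RRz // /b /B; ring.
(* If [h] is in Phi(G), it commutes with [Z2], so the differences along [Z2] vanish and [y]
   centralizes [Z2], hence lies in Phi(G). *)
have tyz : [~ t, y] \in <[z]>.
  case: ht => [_ [[hP tz]|/Z2P[_ tz]]]; last exact: tz.
  apply: tz; apply: cent_Z2_Phi => // k kZ; have kP := Z2_Phi kZ; have kG := PhiG kP.
  have [kE hk] := hy k kG; apply/commute_sym/commgP/eqP/(frame_inj frE) => // g gG.
  rewrite hk // difP // (commute_commg (Phi_Z2_commute hP kZ)) !conj1g.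
  by rewrite (additive_on1 chiD) mulr0 oppr0.
have tG := PhiG tP; have [_ hty] := hy t tG.
have [c ec] := cycle_z tyz; have [k ek] := cycle_z ht_z.
have k0 : k != 0%R by apply: contraNneq ht_nt => k0; rewrite ek k0 expg0.
have c0 : c = 0%R.
  have := hty 1 (group1 G); rewrite ec (frame_zX frE) // difP // => ->.
  by rewrite (additive_on1 lD) mul0r oppr0.
have := hty g1 g1G; rewrite ec c0 (frame_zX frE) // difP // ek (frame_zX frE) //.
by move/esym/eqP; rewrite oppr_eq0 mulf_eq0 (negPf lg1) (negPf k0).
Qed.

(** In the difference of [l * j] at [x] only the term [- l * B x] may fail to be represented, so
    this is all that [s] has to compensate. *)
Let final_core (l s : gT -> 'F_p) g1 : hom_mod Psi l -> rep (E0 Psi) chi l ->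
    (forall u g, u \in Psi -> g \in G -> s (u * g)%g = s g) ->
    (forall x, x \in G -> rep (E0 Psi) chi (fun g => dif s x g - l g * B x g)%R) ->
  g1 \in G -> l g1 != 0%R -> False.
Proof.
move=> hl rl sP reps; apply: final_realization (hl) (sP) _ => x xG.
have rj : rep E chi j by apply/repP; exists h.
have r1 := rep_scale frE (- l x)%R rj; have r2 := rep_scale frE (- b x)%R (rep_E rl).
have r3 := rep_scale frE (- l x)%R (rep_E (Brep xG)).
have r4 := rep_const frE (- l x * b x)%R.
apply: rep_eq (rep_add frE (rep_add frE (rep_E (reps x xG)) r1)
                          (rep_add frE (rep_add frE r2 r3) r4)) _ => g gG.
by have [lD _] := hl; rewrite /dif jM // lD //; ring.
Qed.

(** If [B] were symmetric, conjugating [h] by [x * g] and by [g * x] would agree, so [h] would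
    centralize G' and [N], hence Phi(G), which contains [t]. *)
Let B_not_symmetric : exists x g, [/\ x \in G, g \in G & B x g != B g x].
Proof.
have [sym | ] := boolP [forall x in G, [forall g in G, B x g == B g x]]; last first.
  by case/forall_inPn=> x xG /forall_inPn[g gG nsym]; exists x, g.
have symB x g : x \in G -> g \in G -> B x g = B g x.
  by move=> xG gG; apply/eqP/(forall_inP (forall_inP sym x xG)).
case/negP: ht_nt; apply/commgP.
have hxg x g : x \in G -> g \in G -> h ^ (x * g) = h ^ (g * x).
  move=> xG gG; apply: (frame_inj frE); rewrite ?(frameJ frE) ?groupM //.
  move=> k kG; have [gk xk] := (groupM gG kG, groupM xG kG).
  rewrite -!conjgM -!mulgA -!/(j _) (jM xG gk) (jM gG kG) (jM gG xk) (jM xG kG).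
  by rewrite (B1 xG gG kG) (B1 gG xG kG) (symB x g xG gG); ring.
suff: 'Phi(G) \subset 'C[h] by move/subsetP/(_ t tP)/cent1P/commute_sym.
rewrite PhiGN join_subG; apply/andP; split; last by rewrite sub_cent1.
rewrite gen_subG.
apply/subsetP=> _ /imset2P[x g xG gG ->]; apply/cent1P/commute_sym/commgP/conjg_fixP.
have -> : [~ x, g] = (g * x)^-1 * (x * g) by rewrite commgEl conjgE invMg !mulgA.
by rewrite hxg ?groupV ?groupM // conjgM hxg // conjgK.
Qed.

(** * Choice of the correction [s] *)

Section QuotientFunctional.

Variable q : (gT -> 'F_p) -> 'F_p.
Hypothesis qS : forall f, Sp Psi chi f -> (q f == 0%R) = rep (E0 Psi) chi f.
Hypothesis qe : forall f1 f2, Sp Psi chi f1 -> {in G, f1 =1 f2} -> q f1 = q f2.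
Hypothesis qD : forall f1 f2, Sp Psi chi f1 -> Sp Psi chi f2 ->
  q (fun g => f1 g + f2 g)%R = (q f1 + q f2)%R.
Hypothesis qZ : forall c f, Sp Psi chi f -> q (fun g => c * f g)%R = (c * q f)%R.

Let Shom l : hom_mod Psi l -> Sp Psi chi l.
Proof. by move=> hl; apply: hom_mod_Sp. Qed.

Let Sprod l m : hom_mod Psi l -> hom_mod Psi m ->
  rep (E0 Psi) chi l -> rep (E0 Psi) chi m -> Sp Psi chi (fun g => l g * m g)%R.
Proof. by move=> *; apply: prod_Sp. Qed.

Let qrep f : rep (E0 Psi) chi f -> q f = 0%R.
Proof. by move=> rf; apply/eqP; rewrite qS //; apply: rep_Sp. Qed.

Let rep_q f : Sp Psi chi f -> q f = 0%R -> rep (E0 Psi) chi f.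
Proof. by move=> Sf qf; rewrite -qS // qf. Qed.

Let q_comb3 f1 f2 f3 r (c1 c2 c3 : 'F_p) :
    Sp Psi chi f1 -> Sp Psi chi f2 -> Sp Psi chi f3 -> rep (E0 Psi) chi r ->
    (c1 * q f1 + c2 * q f2 + c3 * q f3 = 0)%R ->
  rep (E0 Psi) chi (fun g => c1 * f1 g + (c2 * f2 g + (c3 * f3 g + r g)))%R.
Proof.
move=> S1 S2 S3 rr e; have Sr := rep_Sp nsPsi sPhiPsi frE0 rr.
have T1 := Sp_scale frE0 c1 S1; have T2 := Sp_scale frE0 c2 S2.
have T3 := Sp_scale frE0 c3 S3.
have T3r := Sp_add frE0 T3 Sr; have T23r := Sp_add frE0 T2 T3r.
apply: rep_q; first exact: (Sp_add frE0 T1 T23r).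
by rewrite qD // qD // qD // !qZ // (qrep rr) addr0 addrA.
Qed.

(** The obstruction to taking [s = 0] in [final_core]. *)
Let th (l : gT -> 'F_p) x := q (fun g => l g * B x g)%R.

Let SpB l x : hom_mod Psi l -> rep (E0 Psi) chi l -> x \in G ->
  Sp Psi chi (fun g => l g * B x g)%R.
Proof. by move=> hl rl xG; apply: Sprod => //; [apply: B1m | apply: Brep]. Qed.

Let th_hom l : hom_mod Psi l -> rep (E0 Psi) chi l -> hom_mod Psi (th l).
Proof.
move=> hl rl; apply: hom_modI.
  move=> x y xG yG; rewrite /th -qD ?SpB //; apply: qe; first by apply: SpB; rewrite ?groupM.
  by move=> g gG; rewrite (B2 gG xG yG) mulrDr.
apply: qrep; apply: rep_eq (rep_const frE0 0%R) _ => g gG.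
by rewrite Bh // mulr0.
Qed.

(* Here [rho] is solved from [q (dif (l * j + rho * l0) x) = 0] for all [x], where
   [l * B x] is the only nonlinear contribution of [l * j]. *)
Let unrepresented_false l0 : hom_mod Psi l0 -> q l0 = 1%R -> False.
Proof.
move=> hl0 ql0; have [x0 [g0 [x0G g0G ne]]] := B_not_symmetric.
have [x [g [xG gG nz]]] : exists x g, [/\ x \in G, g \in G & B x g != 0%R].
  have [e | nz] := eqVneq (B x0 g0) 0%R; last by exists x0, g0.
  by exists g0, x0; split=> //; rewrite e eq_sym in ne.
pose l := B x; have hl : hom_mod Psi l := B1m xG; have rl : rep (E0 Psi) chi l := Brep xG.
(* This [a] gives [q rho = - a], and then [- rho y - l0 y * q rho] is exactly [th l y]. *)
have hth := th_hom hl rl; pose a : 'F_p := (q (th l) / 2%:R)%R.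
have aE : (a * 2%:R)%R = q (th l) by rewrite mulfVK ?two_neq0.
pose rho g := ((- 1) * th l g + a * l0 g)%R.
have hrho : hom_mod Psi rho.
  have [[thD _] [l0D _]] := (hth, hl0); apply: hom_modI.
    by move=> y k yG kG; rewrite /rho thD // l0D //; ring.
  by rewrite /rho (proj2 hth _ hPsi) (proj2 hl0 _ hPsi); ring.
have qrho : q rho = (- a)%R.
  have Sth := Shom hth; have Sl0 := Shom hl0.
  by rewrite qD ?Sp_scale // !qZ // ql0 -aE; ring.
apply: (@final_core l (fun g => rho g * l0 g)%R g) => //.
  by move=> u k uP kG; rewrite !(hom_mod_inv nsPsi) //.
move=> y yG; have [[rhoD _] [l0D _]] := (hrho, hl0).
have r := rep_const frE0 (- (rho y * l0 y))%R.
have := q_comb3 (c1 := (- rho y)%R) (c2 := (- l0 y)%R) (c3 := (- 1)%R)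
  (Shom hl0) (Shom hrho) (SpB hl rl yG) r.
rewrite ql0 qrho -/(th l y) => /(_ _) rr; apply: rep_eq (rr _) _.
  by rewrite /rho; ring.
by move=> k kG; rewrite /dif rhoD // l0D //; ring.
Qed.

(* If all products of two homomorphisms are represented, [s = 0] works.
   Otherwise [q (nu ^ 2) != 0] for some [nu], and [s = mu * nu ^ 2] with
   [mu = - th l / q (nu ^ 2)] works as soon as [q (th l * nu) = 0]; in
   characteristic 3 this last condition cannot be avoided, and some nonzero [l]
   satisfies it because [B] is not symmetric. *)
Let all_represented_false : (forall l, hom_mod Psi l -> rep (E0 Psi) chi l) -> False.
Proof.
move=> repl; have [x0 [g0 [x0G g0G nsym]]] := B_not_symmetric.
have Spr l m : hom_mod Psi l -> hom_mod Psi m -> Sp Psi chi (fun g => l g * m g)%R.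
  by move=> hl hm; apply: Sprod => //; apply: repl.
have [sq0 | ] := boolP [forall x in G, q (fun g => B x g * B x g)%R == 0%R].
  have sq x : x \in G -> q (fun g => B x g * B x g)%R = 0%R.
    by move=> xG; apply/eqP/(forall_inP sq0).
  (* Polarizes the vanishing squares, 2 being invertible. *)
  have prod0 x y : x \in G -> y \in G -> q (fun g => B x g * B y g)%R = 0%R.
    move=> xG yG; have xyG := groupM xG yG.
    have Sxx := Spr _ _ (B1m xG) (B1m xG); have Syy := Spr _ _ (B1m yG) (B1m yG).
    have Sxy := Spr _ _ (B1m xG) (B1m yG).
    have e : q (fun g => B (x * y)%g g * B (x * y)%g g)%R =
             q (fun g => B x g * B x g + (B y g * B y g + 2%:R * (B x g * B y g)))%R.
      apply: qe; first exact: Spr (B1m xyG) (B1m xyG).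
      by move=> g gG; rewrite (B2 gG xG yG); ring.
    have S2 := Sp_scale frE0 2%:R%R Sxy.
    move: e; rewrite sq // qD ?Sp_add // qD // qZ // !sq // !add0r => /esym/eqP.
    by rewrite mulf_eq0 (negPf two_neq0) => /eqP.
  have [x [g [xG gG nz]]] : exists x g, [/\ x \in G, g \in G & B x g != 0%R].
    have [e | nz] := eqVneq (B x0 g0) 0%R; last by exists x0, g0.
    by exists g0, x0; split=> //; rewrite e eq_sym in nsym.
  apply: (@final_core (B x) (fun=> 0%R) g) => //; first exact: B1m.
    exact: Brep.
  move=> y yG; have S := SpB (B1m xG) (Brep xG) yG.
  have rS := rep_q S (prod0 x y xG yG).
  by apply: rep_eq (rep_scale frE0 (- 1)%R rS) _ => k kG; rewrite /dif; ring.
case/forall_inPn=> x1 x1G; set nu := B x1 => r0; pose r := q (fun g => nu g * nu g)%R.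
have hnu : hom_mod Psi nu := B1m x1G.
have Snn := Spr _ _ hnu hnu; have rnu := repl _ hnu.
pose D l := q (fun g => th l g * nu g)%R.
have main l g : hom_mod Psi l -> D l = 0%R -> g \in G -> l g != 0%R -> False.
  move=> hl Dl gG lg; have rl := repl _ hl; have hth := th_hom hl rl.
  (* The term [- mu y * nu ^ 2] in the difference of [mu * nu ^ 2] then has obstruction [th l y];
     the term in [mu * nu] contributes nothing because [D l = 0]. *)
  pose mu g := (- r^-1 * th l g)%R.
  have hmu : hom_mod Psi mu.
    have [thD th0] := hth; split; first by move=> y k yG kG; rewrite /mu thD //; ring.
    by move=> u uP; rewrite /mu th0 // mulr0.
  have Smn := Spr _ _ hmu hnu.
  have qmn : q (fun g => mu g * nu g)%R = 0%R.
    have e : {in G, (fun k => - r^-1 * (th l k * nu k))%R =1 (fun k => mu k * nu k)%R}.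
      by move=> k kG; rewrite /mu; ring.
    have Stn := Spr _ _ hth hnu.
    by rewrite -(qe (Sp_scale frE0 (- r^-1)%R Stn) e) qZ // -/(D l) Dl mulr0.
  apply: (@final_core l (fun k => mu k * (nu k * nu k))%R g) => //.
    by move=> u k uP kG; rewrite !(hom_mod_inv nsPsi) //.
  move=> y yG; have [[muD _] [nuD _]] := (hmu, hnu).
  have rr := rep_add frE0 (rep_scale frE0 (- (nu y * nu y))%R (repl _ hmu))
    (rep_add frE0 (rep_scale frE0 (- (2%:R * mu y * nu y))%R rnu)
                  (rep_const frE0 (- (mu y * (nu y * nu y)))%R)).
  have := q_comb3 (c1 := (- mu y)%R) (c2 := (- (2%:R * nu y))%R) (c3 := (- 1)%R)
    Snn Smn (SpB hl rl yG) rr.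
  rewrite qmn -/r -/(th l y) => /(_ _) R; apply: rep_eq (R _) _.
    have mur : (mu y * r = - th l y)%R by rewrite /mu mulrAC mulNr mulVf ?mulN1r.
    by rewrite mulr0 addr0 mulNr mur; ring.
  by move=> k kG; rewrite /dif muD // nuD //; ring.
have [g1 g1G nug1] : exists2 g, g \in G & nu g != 0%R.
  apply/exists_inP; apply: contraR r0 => /exists_inPn nu0.
  apply/eqP/qrep; apply: rep_eq (rep_const frE0 0%R) _ => g gG.
  by have := nu0 g gG; rewrite negbK => /eqP ->; rewrite mulr0.
have Dnu : D nu != 0%R.
  by apply: contraTneq isT => Dn; case: (main nu g1).
(* Every [l] is proportional to [nu]: subtracting the multiple of [nu] that kills [D] leaves [m],
   which [main] forces to vanish. *)
have mult l g : hom_mod Psi l -> g \in G -> (l g * nu g1 = l g1 * nu g)%R.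
  move=> hl gG; apply/eqP; apply: contraT => ne; exfalso.
  pose c := (D l / D nu)%R; pose m k := (l k + (- c) * nu k)%R.
  have hm : hom_mod Psi m.
    have [[lD l0] [nuD nu0]] := (hl, hnu); split.
      by move=> y k yG kG; rewrite /m lD // nuD //; ring.
    by move=> u uP; rewrite /m l0 // nu0 // mulr0 addr0.
  have thm k : k \in G -> th m k = (th l k + (- c) * th nu k)%R.
    move=> kG; have Sl := SpB hl (repl _ hl) kG; have Sn := SpB hnu rnu kG.
    rewrite /th -qZ // -qD ?Sp_scale //; apply/esym/qe.
      by apply: Sp_add => //; apply: Sp_scale.
    by move=> u uG; rewrite /m; ring.
  have Dm : D m = 0%R.
    have St := Spr _ _ (th_hom hl (repl _ hl)) hnu.
    have Sn := Spr _ _ (th_hom hnu rnu) hnu.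
    have -> : D m = (D l + (- c) * D nu)%R.
      rewrite /D -qZ // -qD ?Sp_scale //; apply/esym/qe.
        by apply: Sp_add => //; apply: Sp_scale.
      by move=> u uG; rewrite thm //; ring.
    by rewrite mulNr divfK // subrr.
  have [mg | mg] := eqVneq (m g) 0%R; last exact: (main m g).
  have [mg1 | mg1] := eqVneq (m g1) 0%R; last exact: (main m g1).
  case/eqP: ne; have lk k : m k = 0%R -> l k = (c * nu k)%R.
    by move=> mk; apply: (subIr (c * nu k)%R); rewrite subrr -mk /m mulNr.
  by rewrite (lk _ mg) (lk _ mg1); ring.
case/eqP: nsym.
(* Proportionality in both arguments makes [B] a multiple of [nu x * nu g], hence symmetric. *)
have Bxg x g : x \in G -> g \in G ->
    (B x g * nu g1 * nu g1 = B g1 g1 * nu x * nu g)%R.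
  move=> xG gG; rewrite (mult _ _ (B1m xG) gG) mulrAC.
  by rewrite (mult (B^~ g1) _ (B2m g1G) xG).
apply: (mulIf nug1); apply: (mulIf nug1).
by rewrite !Bxg // mulrAC.
Qed.

Lemma final_contradiction_q : False.
Proof.
apply: all_represented_false => l hl; apply: contraT => nr; exfalso.
have Sl := Shom hl; have ql : q l != 0%R by rewrite qS.
apply: (@unrepresented_false (fun g => (q l)^-1 * l g)%R); last by rewrite qZ // mulVf.
have [lD l0] := hl; split; first by move=> x y xG yG; rewrite lD //; ring.
by move=> u uP; rewrite l0 // mulr0.
Qed.

End QuotientFunctional.

Lemma final_contradiction_chi : False.
Proof.
have [q [qS qe qD qZ]] := quotient_functional nsPsi sPhiPsi frE0.
exact: final_contradiction_q qS qe qD qZ.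
Qed.

End Character.

Lemma final_contradiction : False.
Proof. by have [chi /final_contradiction_chi] := chi_exists. Qed.

End Final.

Lemma inner_p_contradiction : False.
Proof. by have [h [t /final_contradiction]] := final_pair_exists. Qed.

End NoOuterAutomorphism.

(** * Passage to ['L_3(G)] and the p-th powers *)

Theorem theorem5p1 (gT : finGroupType) (G : {group gT}) (p : nat) :
  prime p -> odd p -> p.-group G -> ~~ abelian G -> cyclic 'Z(G) ->
  ~~ ('C_G('L_3(G) * pow_subgroup G p) \subset 'L_3(G) * pow_subgroup G p) ->
  exists2 a : {perm gT}, a \in Aut G & #[a] = p /\ ~ inner_aut G a.
Proof.
move=> pr_p odd_p pG nabG cZ.
have nsLG : 'L_3(G) <| G by apply: lcn_normal.
have nsMG : 'Mho^1(G) <| G by apply: gFnormal.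
have -> : pow_subgroup G p = 'Mho^1(G) by rewrite (MhoE _ pG) expn1.
rewrite -norm_joinEr; last first.
  exact: subset_trans (normal_sub nsMG) (normal_norm nsLG).
set N := 'L_3(G) <*> 'Mho^1(G) => nCN.
have nsNG : N <| G by apply: normalY.
have [sLN sMN] : 'L_3(G) \subset N /\ 'Mho^1(G) \subset N by rewrite joing_subl joing_subr.
have PhiE := Phi_joing pG.
have sG'Phi : G^`(1) \subset 'Phi(G) by rewrite PhiE joing_subl.
have PhiGN : 'Phi(G) = G^`(1) <*> N.
  apply/eqP; rewrite PhiE eqEsubset !join_subG !joing_subl joing_subr /=.
  rewrite (subset_trans sMN (joing_subr _ _)) andbT.
  exact: subset_trans (lcn_subS 2 G) (joing_subl _ _).
have Nexp g : g \in G -> g ^+ p \in N.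
  move=> gG; apply: (subsetP sMN); rewrite (MhoE _ pG); apply: mem_gen.
  by apply/imsetP; exists g; rewrite ?expn1.
have Ncen f g : f \in 'Phi(G) -> g \in G -> [~ f, g] \in N.
  move=> fP gG; suff /subsetP : [~: 'Phi(G), G] \subset N by apply; apply: mem_commg.
  have nN := normal_norm nsNG; have nPhi := subset_trans (Phi_sub G) nN.
  (* Modulo [N], both factors of Phi(G) are central: G' because ['L_3(G)] is in [N], and ['Mho^1(G)]
     because it is itself in [N]. *)
  rewrite -quotient_cents2 // PhiE quotientY ?join_subG; last 2 first.
  - exact: subset_trans (der_sub 1 G) nN.
  - exact: subset_trans (normal_sub nsMG) nN.
  rewrite !quotient_cents2 ?(subset_trans (der_sub 1 G)) ?(subset_trans (normal_sub nsMG)) //.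
  rewrite -lcn2 -lcnSn sLN /=; apply: subset_trans sMN.
  by rewrite commg_subl normal_norm.
(* Stating the existence as a boolean makes the case distinction constructive. *)
have [|noouter] := boolP [exists a in Aut G, (#[a] == p) &&
    ~~ [exists y in G, [forall x in G, a x == x ^ y]]].
  case/exists_inP=> a aG /andP[/eqP oa out]; exists a => //; split=> // - [y yG ay].
  by case/negP: out; apply/exists_inP; exists y => //; apply/forall_inP=> x xG; rewrite ay.
have inner_p (a : {perm gT}) : a \in Aut G -> #[a] = p ->
    exists2 y, y \in G & {in G, forall x, a x = x ^ y}.
  move=> aG oa; move/exists_inPn/(_ a aG): noouter; rewrite oa eqxx /= negbK.
  by case/exists_inP=> y yG /forall_inP ay; exists y => // x xG; apply/eqP/ay.
have ntZ : 'Z(G) != 1.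
  rewrite (center_nil_eq1 (pgroup_nil pG)); apply: contra nabG => /eqP ->.
  exact: abelian1.
have [_ pZ _] := pgroup_pdiv (pgroupS (center_sub G) pG) ntZ.
have [z zZ oz] := Cauchy pr_p pZ.
case: (@inner_p_contradiction gT G p z pr_p odd_p pG nabG cZ zZ oz inner_p
  [group of N]) => //.
by rewrite PhiGN joing_subr.
Qed.
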